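(* $\mathsf{RCA}_0$ proves that $\mathsf{HT}^{\leq 3}_3$ implies $\mathsf{ACA}_0$.
   Context: $\mathsf{RCA}_0$ is the standard base system of reverse mathematics: the subsystem of second-order arithmetic consisting of the basic axioms of arithmetic, $\Sigma^0_1$-induction, and $\Delta^0_1$-comprehension. $\mathsf{ACA}_0$ is $\mathsf{RCA}_0$ together with the arithmetical comprehension scheme. $\mathbb{N}$ denotes the set of positive integers. For a finite nonempty $F\subseteq\mathbb{N}$, $\sum F$ denotes the sum of the elements of $F$. For $X\subseteq\mathbb{N}$ and $n\geq 1$, $\mathrm{FS}^{\leq n}(X)=\{\sum F \mid F\subseteq X \text{ and } 1\leq |F|\leq n\}$. A set $Z\subseteq\mathbb{N}$ is monochromatic for a coloring $c$ if $c(x)=c(y)$ for all $x,y\in Z$. $\mathsf{HT}^{\leq n}_k$ is the statement (of second-order arithmetic) that for every coloring $c:\mathbb{N}\to\{0,\dots,k-1\}$ there is an infinite set $X\subseteq\mathbb{N}$ such that $\mathrm{FS}^{\leq n}(X)$ is monochromatic for $c$. *)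

(* Defs.v *)
From Stdlib Require Import List Arith.
Import ListNotations.

(** De Bruijn indices, with two independent index spaces: [fAll], [fEx] bind number variables, [fAllS], [fExS] bind set
    variables. The only set terms are set variables, so a set variable is just
    its index. *)

Inductive term : Type :=
| tVar (n : nat)
| tZero
| tOne
| tAdd (s t : term)
| tMul (s t : term).

Inductive form : Type :=
| fBot
| fEq (s t : term)
| fLt (s t : term)
| fMem (t : term) (X : nat)
| fImp (A B : form)
| fAnd (A B : form)
| fOr (A B : form)
| fAll (A : form)
| fEx (A : form)
| fAllS (A : form)
| fExS (A : form).

Definition fNeg (A : form) : form := fImp A fBot.
Definition fTop : form := fNeg fBot.
Definition fIff (A B : form) : form := fAnd (fImp A B) (fImp B A).

Local Infix "+" := tAdd.
Local Infix "*" := tMul.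
Local Infix "==" := fEq (at level 70).
Local Infix "<" := fLt.
Local Infix "∈" := fMem (at level 70).
Local Infix "∧" := fAnd (at level 80, right associativity).
Local Infix "∨" := fOr (at level 85, right associativity).
Local Infix "⇒" := fImp (at level 90, right associativity).
Local Infix "⇔" := fIff (at level 95).
Local Notation "$ n" := (tVar n) (at level 1, format "$ n").

Fixpoint tsubst (sigma : nat -> term) (t : term) : term :=
  match t with
  | tVar n => sigma n
  | tZero => tZero
  | tOne => tOne
  | tAdd s t => tAdd (tsubst sigma s) (tsubst sigma t)
  | tMul s t => tMul (tsubst sigma s) (tsubst sigma t)
  end.

Definition tshift (m : nat) : term -> term := tsubst (fun n => tVar (m + n)%nat).

Definition up (sigma : nat -> term) (n : nat) : term :=
  match n with 0 => tVar 0 | S n => tshift 1 (sigma n) end.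

Definition upS (rho : nat -> nat) (X : nat) : nat :=
  match X with 0 => 0 | S X => S (rho X) end.

Fixpoint fsubst (sigma : nat -> term) (rho : nat -> nat) (A : form) : form :=
  match A with
  | fBot => fBot
  | fEq s t => fEq (tsubst sigma s) (tsubst sigma t)
  | fLt s t => fLt (tsubst sigma s) (tsubst sigma t)
  | fMem t X => fMem (tsubst sigma t) (rho X)
  | fImp A B => fImp (fsubst sigma rho A) (fsubst sigma rho B)
  | fAnd A B => fAnd (fsubst sigma rho A) (fsubst sigma rho B)
  | fOr A B => fOr (fsubst sigma rho A) (fsubst sigma rho B)
  | fAll A => fAll (fsubst (up sigma) rho A)
  | fEx A => fEx (fsubst (up sigma) rho A)
  | fAllS A => fAllS (fsubst sigma (upS rho) A)
  | fExS A => fExS (fsubst sigma (upS rho) A)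
  end.

Definition shift : form -> form := fsubst (fun n => tVar (S n)) (fun X => X).
Definition shiftS : form -> form := fsubst tVar S.

Definition inst (t : term) : form -> form :=
  fsubst (fun n => match n with 0 => t | S n => tVar n end) (fun X => X).
Definition instS (Y : nat) : form -> form :=
  fsubst tVar (fun X => match X with 0 => Y | S X => X end).

(** Classical natural deduction with equality; [prv T G A]: [A] is derivable from the axioms [T] and the assumptions [G].
    The eigenvariable condition of the quantifier rules concerns [G] only, so an
    axiom with free variables has the force of its universal closure. *)

Inductive prv (T : form -> Prop) : list form -> form -> Prop :=
| prv_ax G A : T A -> prv T G A
| prv_hyp G A : In A G -> prv T G A
| prv_raa G A : prv T (fNeg A :: G) fBot -> prv T G A
| prv_impI G A B : prv T (A :: G) B -> prv T G (A ⇒ B)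
| prv_impE G A B : prv T G (A ⇒ B) -> prv T G A -> prv T G B
| prv_andI G A B : prv T G A -> prv T G B -> prv T G (A ∧ B)
| prv_andE1 G A B : prv T G (A ∧ B) -> prv T G A
| prv_andE2 G A B : prv T G (A ∧ B) -> prv T G B
| prv_orI1 G A B : prv T G A -> prv T G (A ∨ B)
| prv_orI2 G A B : prv T G B -> prv T G (A ∨ B)
| prv_orE G A B C :
    prv T G (A ∨ B) -> prv T (A :: G) C -> prv T (B :: G) C -> prv T G C
| prv_allI G A : prv T (map shift G) A -> prv T G (fAll A)
| prv_allE G A t : prv T G (fAll A) -> prv T G (inst t A)
| prv_exI G A t : prv T G (inst t A) -> prv T G (fEx A)
| prv_exE G A B :
    prv T G (fEx A) -> prv T (A :: map shift G) (shift B) -> prv T G B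
| prv_allSI G A : prv T (map shiftS G) A -> prv T G (fAllS A)
| prv_allSE G A Y : prv T G (fAllS A) -> prv T G (instS Y A)
| prv_exSI G A Y : prv T G (instS Y A) -> prv T G (fExS A)
| prv_exSE G A B :
    prv T G (fExS A) -> prv T (A :: map shiftS G) (shiftS B) -> prv T G B
| prv_refl G t : prv T G (t == t)
| prv_eqE G A s t : prv T G (s == t) -> prv T G (inst s A) -> prv T G (inst t A).

Definition proves (T : form -> Prop) (A : form) : Prop := prv T [] A.

(** The bound of a bounded quantifier does not contain the bound variable,
    whence [tshift 1 t]. Set parameters are allowed in all classes. *)
Inductive bounded : form -> Prop :=
| bounded_bot : bounded fBot
| bounded_eq s t : bounded (s == t)
| bounded_lt s t : bounded (s < t)
| bounded_mem t X : bounded (t ∈ X)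
| bounded_imp A B : bounded A -> bounded B -> bounded (A ⇒ B)
| bounded_and A B : bounded A -> bounded B -> bounded (A ∧ B)
| bounded_or A B : bounded A -> bounded B -> bounded (A ∨ B)
| bounded_all t A : bounded A -> bounded (fAll ($0 < tshift 1 t ⇒ A))
| bounded_ex t A : bounded A -> bounded (fEx ($0 < tshift 1 t ∧ A)).

Inductive Sigma01 : form -> Prop :=
| Sigma01_ex A : bounded A -> Sigma01 (fEx A).

Inductive Pi01 : form -> Prop :=
| Pi01_all A : bounded A -> Pi01 (fAll A).

Fixpoint arithmetical (A : form) : Prop :=
  match A with
  | fBot | fEq _ _ | fLt _ _ | fMem _ _ => True
  | fImp A B | fAnd A B | fOr A B => arithmetical A /\ arithmetical B
  | fAll A | fEx A => arithmetical A
  | fAllS _ | fExS _ => False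
  end.

Inductive basic_axiom : form -> Prop :=
| ax_succ_zero : basic_axiom (fNeg ($0 + tOne == tZero))
| ax_succ_inj : basic_axiom ($0 + tOne == $1 + tOne ⇒ $0 == $1)
| ax_add_zero : basic_axiom ($0 + tZero == $0)
| ax_add_succ : basic_axiom ($0 + ($1 + tOne) == ($0 + $1) + tOne)
| ax_mul_zero : basic_axiom ($0 * tZero == tZero)
| ax_mul_succ : basic_axiom ($0 * ($1 + tOne) == $0 * $1 + $0)
| ax_lt_zero : basic_axiom (fNeg ($0 < tZero))
| ax_lt_succ : basic_axiom ($0 < $1 + tOne ⇔ ($0 < $1 ∨ $0 == $1)).

(** In the schemes, number variable 0 of [A] is the induction, respectively
    comprehension, variable; all other free variables are parameters. *)
Definition induction (A : form) : form :=
  inst tZero A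
  ∧ fAll (A ⇒ fsubst (fun n => match n with 0 => $0 + tOne | S n => $(S n) end)
                     (fun X => X) A)
  ⇒ fAll A.

(** [shiftS] makes the comprehended set not occur free in [A]. *)
Definition comprehension (A : form) : form :=
  fExS (fAll ($0 ∈ 0 ⇔ shiftS A)).

Inductive RCA0 : form -> Prop :=
| RCA0_basic A : basic_axiom A -> RCA0 A
| RCA0_induction A : Sigma01 A -> RCA0 (induction A)
| RCA0_comprehension A B :
    Sigma01 A -> Pi01 B -> RCA0 (fAll (A ⇔ B) ⇒ comprehension A).

Inductive ACA0 : form -> Prop :=
| ACA0_RCA0 A : RCA0 A -> ACA0 A
| ACA0_comprehension A : arithmetical A -> ACA0 (comprehension A).

Fixpoint numeral (k : nat) : term :=
  match k with 0 => tZero | S k => numeral k + tOne end.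

Definition bigAnd : list form -> form := fold_right fAnd fTop.
Definition bigOr : list form -> form := fold_right fOr fBot.
Definition bigAdd : list term -> term := fold_right tAdd tZero.

(** The usual pairing function of RCA_0, (i, j) = (i + j)^2 + i. *)
Definition pair (s t : term) : term := (s + t) * (s + t) + s.

(** [c] is (the graph of) a function from the positive integers to
    {0, ..., k-1}. *)
Definition coloring (k c : nat) : form :=
  fAll ($0 ∈ c ⇒ fEx (fEx (tZero < $1 ∧ $0 < numeral k ∧ $2 == pair $1 $0)))
  ∧ fAll (tZero < $0 ⇒
      fEx (pair $1 $0 ∈ c ∧ fAll (pair $2 $0 ∈ c ⇒ $0 == $1))).

Definition positive (X : nat) : form := fAll ($0 ∈ X ⇒ tZero < $0).
Definition infinite (X : nat) : form := fAll (fEx ($1 < $0 ∧ $0 ∈ X)).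

(** [z] is the sum of an [m]-element subset of [X]: there are pairwise distinct
    x_0, ..., x_{m-1} in [X] with sum [z]; x_i is number variable i below. *)
Definition is_sum (m X : nat) (z : term) : form :=
  Nat.iter m fEx
    (bigAnd (map (fun i => $i ∈ X) (seq 0 m))
     ∧ bigAnd (flat_map (fun j => map (fun i => fNeg ($i == $j)) (seq 0 j)) (seq 0 m))
     ∧ tshift m z == bigAdd (map tVar (seq 0 m))).

Definition FS (n X : nat) (z : term) : form :=
  bigOr (map (fun m => is_sum m X z) (seq 1 n)).

(** [Z] must commute with renaming of number variables. *)
Definition monochromatic (c : nat) (Z : term -> form) : form :=
  fAll (fAll (Z $1 ∧ Z $0 ⇒ fEx (pair $2 $0 ∈ c ∧ pair $1 $0 ∈ c))).

(** Hindman's theorem for sums of at most [n] elements and [k] colors, where [n]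
    and [k] are metatheoretic. Number variables range over 0 too, so positivity
    is explicit. *)
Definition HT (n k : nat) : form :=
  fAllS (coloring k 0 ⇒
    fExS (positive 0 ∧ infinite 0 ∧ monochromatic 1 (FS n 0))).

(* Main.v *)
From HB Require Import structures.
From Stdlib Require Import Setoid List Arith Lia Ring Classical ClassicalEpsilon.
From Stdlib Require Import FunctionalExtensionality PropExtensionality ProofIrrelevance.
From Stdlib Require Import RelationClasses Cantor.
From mathcomp Require ssreflect ssrfun ssrbool eqtype ssrnat choice order ssralg ssrnum boolp.
From mathcomp Require Import lra.
Require Import Defs.
Import ListNotations.

(** By the completeness theorem it suffices to show that every model of RCA0 and
    HT 3 3 (with an arbitrary second-order part) satisfies arithmetical
    comprehension, and for this it suffices to form the set of all [x] enumerated
    at some stage by a bounded relation. Write numbers in base 7, let [l] be the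
    largest power of 7 dividing [n], and let [r] be the lowest nonzero digit of
    [n]. The color of [n] is the cubic character of [r] modulo 7 plus the parity
    of the number of splits of [n], taken modulo 3: a split is a nonzero digit of
    [n], at [q] say, such that some number below [l] is first enumerated at a
    stage between [n mod q] and [q]. As [r], [2 r], [3 r] have three different characters, a
    solution [X] for sums of at most three elements never contains three elements
    that are congruent modulo a power of 7 and not divisible by it; hence [l] is
    unbounded on [X]. If some number below [l] were enumerated only after stage
    [n], for some [n] in [X], then adding to [n] a sufficiently late element of
    [X] would create exactly one split and change the color. So [X] bounds the
    enumeration and makes its range decidable. *)

(** Three colors have to serve two purposes, which is why the two ingredients are added modulo 3.
    Adding to [n] a number divisible by a higher power of 7 keeps [r], so an unchanged color means
    an unchanged parity, 0 and 1 being different modulo 3. Conversely, the parity shifts the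
    character by 0 or 1 only, so a single color admits just two characters, while [r], [2 r], [3 r]
    show all three. The prime 7 is the least one with a nontrivial cubic character, and it is odd: a
    number with digits 0 and 1 in base 7 has the parity of its number of ones, so splits need not be
    counted. The obstacle is that only Sigma01 induction is available. The infinite pigeonhole
    principle for residues would need more; strong collection for Sigma01 predicates replaces it,
    and also supplies the stage by which every number below [l] that is ever enumerated has
    appeared. Full arithmetical comprehension then comes from removing quantifiers one at a time,
    each being absorbed into a new set parameter. *)

Definition scons {T : Type} (x : T) (e : nat -> T) (n : nat) : T :=
  match n with 0 => x | S n => e n end.

Lemma scons_comp (T U : Type) (f : T -> U) x e :
  (fun n => f (scons x e n)) = scons (f x) (fun n => f (e n)).
Proof. apply functional_extensionality; intros [|n]; reflexivity. Qed.

Lemma scons_eta (T : Type) (e : nat -> T) : scons (e 0) (fun n => e (S n)) = e.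
Proof. apply functional_extensionality; intros [|n]; reflexivity. Qed.

(** * Quotients by chosen representatives *)

Section Quotient.
Context {T : Type} (R : T -> T -> Prop) {HR : Equivalence R}.

Definition repr (x : T) : T := epsilon (inhabits x) (R x).
Definition quotient : Type := {x : T | repr x = x}.

Lemma repr_rel x : R x (repr x).
Proof. apply (epsilon_spec (inhabits x) (R x)). exists x. reflexivity. Qed.

(** The choice depends on the predicate [R x] only, which by extensionality is the same for related
    elements. Classes are thus equal in the sense of Rocq, as the interpretation of [fEq] and the
    algebraic interfaces require. *)
Lemma repr_eq x y : repr x = repr y <-> R x y.
Proof.
  split.
  - intros H. rewrite (repr_rel x), H. symmetry. apply repr_rel.
  - intros H. unfold repr. replace (R x) with (R y).
    + f_equal. apply proof_irrelevance.
    + apply functional_extensionality; intros z. apply propositional_extensionality.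
      now rewrite H.
Qed.

Definition class (x : T) : quotient :=
  exist _ (repr x) (proj2 (repr_eq (repr x) x) (symmetry (repr_rel x))).

Lemma class_eq x y : class x = class y <-> R x y.
Proof.
  rewrite <- repr_eq. split; [now intros [=]|].
  intros H. apply subset_eq_compat. exact H.
Qed.

Lemma class_val (z : quotient) : class (proj1_sig z) = z.
Proof. destruct z as [x Hx]. apply subset_eq_compat. exact Hx. Qed.
End Quotient.

(** * Substitution *)

Lemma tsubst_comp sigma tau t :
  tsubst tau (tsubst sigma t) = tsubst (fun n => tsubst tau (sigma n)) t.
Proof. induction t; simpl; congruence. Qed.

Lemma up_comp sigma tau :
  (fun n => tsubst (up tau) (up sigma n)) = up (fun n => tsubst tau (sigma n)).
Proof.
  apply functional_extensionality; intros [|n]; [reflexivity|].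
  simpl. unfold tshift. now rewrite !tsubst_comp.
Qed.

Lemma upS_comp rho pi : (fun X => upS pi (upS rho X)) = upS (fun X => pi (rho X)).
Proof. apply functional_extensionality; intros [|n]; reflexivity. Qed.

Lemma fsubst_comp sigma rho tau pi A :
  fsubst tau pi (fsubst sigma rho A)
  = fsubst (fun n => tsubst tau (sigma n)) (fun X => pi (rho X)) A.
Proof.
  revert sigma rho tau pi.
  induction A; intros; simpl; rewrite ?tsubst_comp, ?IHA1, ?IHA2, ?IHA, ?up_comp, ?upS_comp;
    reflexivity.
Qed.

Lemma tsubst_id t : tsubst tVar t = t.
Proof. induction t; simpl; congruence. Qed.

Lemma up_id : up tVar = tVar.
Proof. apply functional_extensionality; intros [|n]; reflexivity. Qed.

Lemma upS_id : upS (fun X => X) = (fun X => X).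
Proof. apply functional_extensionality; intros [|n]; reflexivity. Qed.

Lemma fsubst_id A : fsubst tVar (fun X => X) A = A.
Proof.
  induction A; simpl; rewrite ?tsubst_id, ?up_id, ?upS_id; congruence.
Qed.

Lemma inst_subst t sigma rho A :
  inst t (fsubst (up sigma) rho A) = fsubst (scons t sigma) rho A.
Proof.
  unfold inst. rewrite fsubst_comp. f_equal.
  apply functional_extensionality; intros [|n]; [reflexivity|].
  simpl. unfold tshift. rewrite tsubst_comp. apply tsubst_id.
Qed.

Lemma instS_subst Y sigma rho A :
  instS Y (fsubst sigma (upS rho) A) = fsubst sigma (scons Y rho) A.
Proof.
  unfold instS. rewrite fsubst_comp. f_equal.
  - apply functional_extensionality; intros n. apply tsubst_id.
  - apply functional_extensionality; intros [|n]; reflexivity.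
Qed.

Lemma subst_inst t sigma rho A :
  fsubst sigma rho (inst t A) = fsubst (scons (tsubst sigma t) sigma) rho A.
Proof.
  unfold inst. rewrite fsubst_comp. f_equal.
  apply functional_extensionality; intros [|n]; reflexivity.
Qed.

Lemma subst_instS Y sigma rho A :
  fsubst sigma rho (instS Y A) = fsubst sigma (scons (rho Y) rho) A.
Proof.
  unfold instS. rewrite fsubst_comp. f_equal.
  apply functional_extensionality; intros [|n]; reflexivity.
Qed.

Lemma shift_subst sigma rho A :
  fsubst (up sigma) rho (shift A) = shift (fsubst sigma rho A).
Proof. unfold shift. rewrite !fsubst_comp. reflexivity. Qed.

Lemma shiftS_subst sigma rho A :
  fsubst sigma (upS rho) (shiftS A) = shiftS (fsubst sigma rho A).
Proof.
  unfold shiftS. rewrite !fsubst_comp. f_equal.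
  apply functional_extensionality; intros n. simpl. now rewrite tsubst_id.
Qed.

Lemma map_shift_subst sigma rho G :
  map (fsubst (up sigma) rho) (map shift G) = map shift (map (fsubst sigma rho) G).
Proof. rewrite !map_map. apply map_ext. intros A. apply shift_subst. Qed.

Lemma map_shiftS_subst sigma rho G :
  map (fsubst sigma (upS rho)) (map shiftS G) = map shiftS (map (fsubst sigma rho) G).
Proof. rewrite !map_map. apply map_ext. intros A. apply shiftS_subst. Qed.

Fixpoint term_bound (t : term) : nat :=
  match t with
  | tVar n => S n
  | tZero | tOne => 0
  | tAdd s t | tMul s t => Nat.max (term_bound s) (term_bound t)
  end.

(** All free variables lie strictly below the bound, so the bound itself is a fresh variable. *)
Fixpoint num_bound (A : form) : nat :=
  match A with
  | fBot => 0
  | fEq s t | fLt s t => Nat.max (term_bound s) (term_bound t)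
  | fMem t X => term_bound t
  | fImp A B | fAnd A B | fOr A B => Nat.max (num_bound A) (num_bound B)
  | fAll A | fEx A => pred (num_bound A)
  | fAllS A | fExS A => num_bound A
  end.

Fixpoint set_bound (A : form) : nat :=
  match A with
  | fBot | fEq _ _ | fLt _ _ => 0
  | fMem t X => S X
  | fImp A B | fAnd A B | fOr A B => Nat.max (set_bound A) (set_bound B)
  | fAll A | fEx A => set_bound A
  | fAllS A | fExS A => pred (set_bound A)
  end.

Lemma tsubst_agree sigma tau t :
  (forall n, n < term_bound t -> sigma n = tau n) -> tsubst sigma t = tsubst tau t.
Proof.
  induction t; simpl; intros H; auto;
    (rewrite IHt1, IHt2; [reflexivity|..]; intros; apply H; lia).
Qed.

Lemma fsubst_agree sigma tau rho pi A :
  (forall n, n < num_bound A -> sigma n = tau n) ->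
  (forall X, X < set_bound A -> rho X = pi X) ->
  fsubst sigma rho A = fsubst tau pi A.
Proof.
  revert sigma tau rho pi; induction A; simpl; intros sigma tau rho pi H1 H2; auto;
    try (f_equal; (apply tsubst_agree || apply IHA1 || apply IHA2);
         intros; (apply H1 || apply H2); lia).
  - f_equal; [apply tsubst_agree; intros; apply H1; lia | apply H2; lia].
  - f_equal. apply IHA; auto. intros [|n] Hn; [reflexivity|].
    simpl. rewrite H1; [reflexivity|lia].
  - f_equal. apply IHA; auto. intros [|n] Hn; [reflexivity|].
    simpl. rewrite H1; [reflexivity|lia].
  - f_equal. apply IHA; auto. intros [|n] Hn; [reflexivity|].
    simpl. rewrite H2; [reflexivity|lia].
  - f_equal. apply IHA; auto. intros [|n] Hn; [reflexivity|].
    simpl. rewrite H2; [reflexivity|lia].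
Qed.

(** * Derivability *)

Lemma prv_weaken T G G' A : prv T G A -> incl G G' -> prv T G' A.
Proof.
  intros H; revert G'; induction H; intros G' HG.
  - now apply prv_ax.
  - apply prv_hyp; auto.
  - apply prv_raa, IHprv. apply incl_cons; [now left|now apply incl_tl].
  - apply prv_impI, IHprv. apply incl_cons; [now left|now apply incl_tl].
  - eapply prv_impE; eauto.
  - apply prv_andI; auto.
  - eapply prv_andE1; eauto.
  - eapply prv_andE2; eauto.
  - apply prv_orI1; auto.
  - apply prv_orI2; auto.
  - eapply prv_orE; [eauto|..];
      [apply IHprv2|apply IHprv3]; (apply incl_cons; [now left|now apply incl_tl]).
  - apply prv_allI, IHprv. now apply incl_map.
  - apply prv_allE; auto.
  - eapply prv_exI; eauto.
  - eapply prv_exE; [eauto|]. apply IHprv2.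
    apply incl_cons; [now left|]. apply incl_tl. now apply incl_map.
  - apply prv_allSI, IHprv. now apply incl_map.
  - apply prv_allSE; auto.
  - eapply prv_exSI; eauto.
  - eapply prv_exSE; [eauto|]. apply IHprv2.
    apply incl_cons; [now left|]. apply incl_tl. now apply incl_map.
  - apply prv_refl.
  - eapply prv_eqE; eauto.
Qed.

(** Axioms may be open formulas. Their instances have to be derivable, though not axioms themselves;
    this makes it legitimate to rename a free variable throughout a derivation. *)
Definition subst_closed (T : form -> Prop) : Prop :=
  forall A G sigma rho, T A -> prv T G (fsubst sigma rho A).

Lemma prv_subst T G A sigma rho :
  subst_closed T -> prv T G A ->
  prv T (map (fsubst sigma rho) G) (fsubst sigma rho A).
Proof.
  intros HT H; revert sigma rho; induction H; intros sigma rho.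
  - now apply HT.
  - apply prv_hyp. now apply in_map.
  - apply prv_raa. apply (IHprv sigma rho).
  - simpl. apply prv_impI. apply (IHprv sigma rho).
  - eapply prv_impE; [apply (IHprv1 sigma rho)|apply IHprv2].
  - simpl. apply prv_andI; auto.
  - eapply prv_andE1. apply (IHprv sigma rho).
  - eapply prv_andE2. apply (IHprv sigma rho).
  - simpl. apply prv_orI1; auto.
  - simpl. apply prv_orI2; auto.
  - eapply prv_orE; [apply (IHprv1 sigma rho)|apply (IHprv2 sigma rho)|apply (IHprv3 sigma rho)].
  - simpl. apply prv_allI. specialize (IHprv (up sigma) rho).
    now rewrite map_shift_subst in IHprv.
  - rewrite subst_inst, <- inst_subst. apply prv_allE. apply (IHprv sigma rho).
  - simpl. apply prv_exI with (tsubst sigma t). rewrite inst_subst, <- subst_inst. auto.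
  - eapply prv_exE; [apply (IHprv1 sigma rho)|].
    specialize (IHprv2 (up sigma) rho). rewrite shift_subst in IHprv2.
    simpl in IHprv2. now rewrite map_shift_subst in IHprv2.
  - simpl. apply prv_allSI. specialize (IHprv sigma (upS rho)).
    now rewrite map_shiftS_subst in IHprv.
  - rewrite subst_instS, <- instS_subst. apply prv_allSE. apply (IHprv sigma rho).
  - simpl. apply prv_exSI with (rho Y). rewrite instS_subst, <- subst_instS. auto.
  - eapply prv_exSE; [apply (IHprv1 sigma rho)|].
    specialize (IHprv2 sigma (upS rho)). rewrite shiftS_subst in IHprv2.
    simpl in IHprv2. now rewrite map_shiftS_subst in IHprv2.
  - simpl. apply prv_refl.
  - rewrite subst_inst, <- inst_subst.
    apply prv_eqE with (tsubst sigma s); [apply (IHprv1 sigma rho)|].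
    rewrite inst_subst, <- subst_inst. auto.
Qed.

Lemma prv_cut T G A B : prv T G A -> prv T (A :: G) B -> prv T G B.
Proof. intros H1 H2. eapply prv_impE; [apply prv_impI, H2|exact H1]. Qed.

(** Lets the free variable [k] act as a Henkin constant: the substitution that sends [k] to 0 and
    shifts every other variable turns the given derivation into the second premise of [prv_exE]. *)
Lemma prv_ex_fresh T G B k :
  subst_closed T -> num_bound B <= k -> (forall C, In C G -> num_bound C <= k) ->
  prv T (inst (tVar k) B :: G) fBot -> prv T (fEx B :: G) fBot.
Proof.
  intros HT HB HG H. eapply prv_exE; [apply prv_hyp; now left|].
  apply (prv_subst _ _ _ (fun n => if n =? k then tVar 0 else tVar (S n)) (fun X => X) HT) in H.
  apply prv_weaken with (1 := H). simpl. apply incl_cons.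
  - left. rewrite subst_inst. rewrite <- (fsubst_id B) at 1.
    apply fsubst_agree; auto. intros [|n] Hn; simpl; [now rewrite Nat.eqb_refl|].
    destruct (Nat.eqb_spec n k); [lia|reflexivity].
  - intros C HC. apply in_map_iff in HC as (D & <- & HD). right. right.
    apply in_map_iff. exists D. split; [|exact HD].
    apply fsubst_agree; auto. intros n Hn.
    specialize (HG D HD). destruct (Nat.eqb_spec n k); [lia|reflexivity].
Qed.

Lemma prv_exS_fresh T G B k :
  subst_closed T -> set_bound B <= k -> (forall C, In C G -> set_bound C <= k) ->
  prv T (instS k B :: G) fBot -> prv T (fExS B :: G) fBot.
Proof.
  intros HT HB HG H. eapply prv_exSE; [apply prv_hyp; now left|].
  apply (prv_subst _ _ _ tVar (fun X => if X =? k then 0 else S X) HT) in H.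
  apply prv_weaken with (1 := H). simpl. apply incl_cons.
  - left. rewrite subst_instS. rewrite <- (fsubst_id B) at 1.
    apply fsubst_agree; auto. intros [|n] Hn; simpl; [now rewrite Nat.eqb_refl|].
    destruct (Nat.eqb_spec n k); [lia|reflexivity].
  - intros C HC. apply in_map_iff in HC as (D & <- & HD). right. right.
    apply in_map_iff. exists D. split; [|exact HD].
    apply fsubst_agree; auto. intros n Hn.
    specialize (HG D HD). destruct (Nat.eqb_spec n k); [lia|reflexivity].
Qed.

(** * Completeness *)

Record structure : Type := Structure {
  num : Type;
  mzero : num;
  mone : num;
  madd : num -> num -> num;
  mmul : num -> num -> num;
  mlt : num -> num -> Prop;
  mset : Type;
  mmem : num -> mset -> Prop }.

Fixpoint eval (M : structure) (e : nat -> num M) (t : term) : num M :=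
  match t with
  | tVar n => e n
  | tZero => mzero M
  | tOne => mone M
  | tAdd s t => madd M (eval M e s) (eval M e t)
  | tMul s t => mmul M (eval M e s) (eval M e t)
  end.

Fixpoint sat (M : structure) (e : nat -> num M) (E : nat -> mset M) (A : form) : Prop :=
  match A with
  | fBot => False
  | fEq s t => eval M e s = eval M e t
  | fLt s t => mlt M (eval M e s) (eval M e t)
  | fMem t X => mmem M (eval M e t) (E X)
  | fImp A B => sat M e E A -> sat M e E B
  | fAnd A B => sat M e E A /\ sat M e E B
  | fOr A B => sat M e E A \/ sat M e E B
  | fAll A => forall x, sat M (scons x e) E A
  | fEx A => exists x, sat M (scons x e) E A
  | fAllS A => forall Y, sat M e (scons Y E) A
  | fExS A => exists Y, sat M e (scons Y E) A
  end.

Definition models (M : structure) (T : form -> Prop) : Prop :=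
  forall A, T A -> forall e E, sat M e E A.

Fixpoint term_code (t : term) : nat :=
  match t with
  | tVar n => to_nat (0, n)
  | tZero => to_nat (1, 0)
  | tOne => to_nat (2, 0)
  | tAdd s t => to_nat (3, to_nat (term_code s, term_code t))
  | tMul s t => to_nat (4, to_nat (term_code s, term_code t))
  end.

Fixpoint form_code (A : form) : nat :=
  match A with
  | fBot => to_nat (0, 0)
  | fEq s t => to_nat (1, to_nat (term_code s, term_code t))
  | fLt s t => to_nat (2, to_nat (term_code s, term_code t))
  | fMem t X => to_nat (3, to_nat (term_code t, X))
  | fImp A B => to_nat (4, to_nat (form_code A, form_code B))
  | fAnd A B => to_nat (5, to_nat (form_code A, form_code B))
  | fOr A B => to_nat (6, to_nat (form_code A, form_code B))
  | fAll A => to_nat (7, form_code A)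
  | fEx A => to_nat (8, form_code A)
  | fAllS A => to_nat (9, form_code A)
  | fExS A => to_nat (10, form_code A)
  end.

Lemma to_nat_pair a b c d : to_nat (a, b) = to_nat (c, d) -> a = c /\ b = d.
Proof. intros H. apply to_nat_inj in H. now inversion H. Qed.

Lemma term_code_inj s t : term_code s = term_code t -> s = t.
Proof.
  revert t; induction s; intros [] H; cbn [term_code] in H; apply to_nat_pair in H as [H1 H2];
    try discriminate; auto; apply to_nat_pair in H2 as [H2 H3]; f_equal; auto.
Qed.

Lemma form_code_inj A B : form_code A = form_code B -> A = B.
Proof.
  revert B; induction A; intros [] H; cbn [form_code] in H; apply to_nat_pair in H as [H1 H2];
    try discriminate; auto; try (f_equal; now auto);
    apply to_nat_pair in H2 as [H2 H3]; f_equal; auto using term_code_inj.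
Qed.

Section Henkin.
Context (T : form -> Prop) (HT : subst_closed T) (A0 : form).
Context (HA0 : ~ prv T [] A0).

Definition form_enum (n : nat) : form := epsilon (inhabits fBot) (fun A => form_code A = n).

Lemma form_enum_code A : form_enum (form_code A) = A.
Proof.
  apply form_code_inj. unfold form_enum.
  apply (epsilon_spec (inhabits fBot) (fun B => form_code B = form_code A)).
  now exists A.
Qed.

Definition bound_all (f : form -> nat) (G : list form) : nat := list_max (map f G).

Lemma bound_all_spec f G C : In C G -> f C <= bound_all f G.
Proof.
  intros H. unfold bound_all.
  assert (HF := proj1 (list_max_le (map f G) _) (le_n _)).
  rewrite Forall_forall in HF. apply HF. now apply in_map.
Qed.

(** Free variables serve as Henkin constants. *)
Definition add_witness (G : list form) : list form :=
  match G with
  | fEx B :: _ => inst (tVar (Nat.max (num_bound B) (bound_all num_bound G))) B :: G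
  | fExS B :: _ => instS (Nat.max (set_bound B) (bound_all set_bound G)) B :: G
  | _ => G
  end.

Lemma add_witness_consistent G : ~ prv T G fBot -> ~ prv T (add_witness G) fBot.
Proof.
  intros H. destruct G as [|[] G]; simpl; auto; intros H1; apply H.
  - apply prv_ex_fresh in H1; [|exact HT|apply Nat.le_max_l|].
    + apply prv_weaken with (1 := H1). intros C [->|HC]; [now left|exact HC].
    + intros C HC. etransitivity; [|apply Nat.le_max_r]. now apply bound_all_spec.
  - apply prv_exS_fresh in H1; [|exact HT|apply Nat.le_max_l|].
    + apply prv_weaken with (1 := H1). intros C [->|HC]; [now left|exact HC].
    + intros C HC. etransitivity; [|apply Nat.le_max_r]. now apply bound_all_spec.
Qed.

Lemma add_witness_incl G : incl G (add_witness G).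
Proof. destruct G as [|[] G]; simpl; try apply incl_refl; apply incl_tl, incl_refl. Qed.

Local Arguments add_witness : simpl never.

Fixpoint stage (n : nat) : list form :=
  match n with
  | 0 => [fNeg A0]
  | S n =>
      if excluded_middle_informative (prv T (form_enum n :: stage n) fBot)
      then stage n
      else add_witness (form_enum n :: stage n)
  end.

Lemma stage_consistent n : ~ prv T (stage n) fBot.
Proof.
  induction n; simpl.
  - intros H. apply HA0. now apply prv_raa.
  - destruct excluded_middle_informative; [exact IHn|]. now apply add_witness_consistent.
Qed.

Lemma stage_mono n m : n <= m -> incl (stage n) (stage m).
Proof.
  induction 1 as [|m _ IH]; [apply incl_refl|]. simpl.
  destruct excluded_middle_informative; [exact IH|].
  eapply incl_tran; [|apply add_witness_incl]. now apply incl_tl.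
Qed.

(** Derivability from some stage rather than membership in one, so that the limit theory is
    deductively closed from the outset. *)
Definition holds (A : form) : Prop := exists n, prv T (stage n) A.

Lemma holds_prv A : prv T [] A -> holds A.
Proof. intros H. exists 0. apply prv_weaken with (1 := H). intros ? []. Qed.

Lemma holds_prv1 A B : holds A -> prv T [A] B -> holds B.
Proof.
  intros [n Hn] H. exists n. eapply prv_cut; [exact Hn|].
  apply prv_weaken with (1 := H). intros C [->|[]]; now left.
Qed.

Lemma holds_prv2 A B C : holds A -> holds B -> prv T [A; B] C -> holds C.
Proof.
  intros [n Hn] [m Hm] H. exists (Nat.max n m).
  apply prv_weaken with (G' := stage (Nat.max n m)) in Hn; [|apply stage_mono; lia].
  apply prv_weaken with (G' := stage (Nat.max n m)) in Hm; [|apply stage_mono; lia].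
  eapply prv_cut; [exact Hm|]. eapply prv_cut.
  - apply prv_weaken with (1 := Hn), incl_tl, incl_refl.
  - apply prv_weaken with (1 := H). intros D [->|[->|[]]]; [now left|now right; left].
Qed.

Lemma holds_consistent : ~ holds fBot.
Proof. intros [n H]. now apply stage_consistent in H. Qed.

Lemma holds_neg A : holds (fNeg A) <-> ~ holds A.
Proof.
  split.
  - intros H1 H2. apply holds_consistent. apply (holds_prv2 _ _ _ H1 H2).
    eapply prv_impE; apply prv_hyp; [now left|now right; left].
  - intros H. exists (S (form_code A)). simpl. rewrite form_enum_code.
    destruct excluded_middle_informative as [H1|H1]; [now apply prv_impI|].
    exfalso. apply H. exists (S (form_code A)). simpl. rewrite form_enum_code.
    destruct excluded_middle_informative; [contradiction|].
    apply prv_hyp. apply add_witness_incl. now left.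
Qed.

(** A formula that holds cannot be inconsistent with the stage at which it is enumerated, so it was
    added there together with its witness. *)
Lemma holds_stage A : holds A ->
  incl (add_witness (A :: stage (form_code A))) (stage (S (form_code A))).
Proof.
  intros H. simpl. rewrite form_enum_code.
  destruct excluded_middle_informative as [H1|H1]; [|apply incl_refl].
  exfalso. assert (H2 : holds (fNeg A)) by (exists (form_code A); now apply prv_impI).
  now apply holds_neg in H2.
Qed.

Lemma holds_ex B : holds (fEx B) -> exists k, holds (inst (tVar k) B).
Proof.
  intros H. eexists. exists (S (form_code (fEx B))). apply prv_hyp.
  apply (holds_stage _ H). left. reflexivity.
Qed.

Lemma holds_exS B : holds (fExS B) -> exists k, holds (instS k B).
Proof.
  intros H. eexists. exists (S (form_code (fExS B))). apply prv_hyp.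
  apply (holds_stage _ H). left. reflexivity.
Qed.

Lemma holds_imp A B : holds (fImp A B) <-> (holds A -> holds B).
Proof.
  split.
  - intros H1 H2. apply (holds_prv2 _ _ _ H1 H2).
    eapply prv_impE; apply prv_hyp; [now left|now right; left].
  - intros H. destruct (classic (holds A)) as [HA|HA].
    + apply (holds_prv1 _ _ (H HA)). apply prv_impI, prv_hyp. now right; left.
    + apply holds_neg in HA. apply (holds_prv1 _ _ HA). apply prv_impI, prv_raa.
      eapply prv_impE; apply prv_hyp; [now right; right; left|now right; left].
Qed.

Lemma holds_and A B : holds (fAnd A B) <-> holds A /\ holds B.
Proof.
  split.
  - intros H; split; apply (holds_prv1 _ _ H);
      [eapply prv_andE1|eapply prv_andE2]; apply prv_hyp; now left.
  - intros [H1 H2]. apply (holds_prv2 _ _ _ H1 H2).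
    apply prv_andI; apply prv_hyp; [now left|now right; left].
Qed.

Lemma holds_or A B : holds (fOr A B) <-> holds A \/ holds B.
Proof.
  split.
  - intros H. apply NNPP. intros HN. apply not_or_and in HN as [H1 H2].
    apply holds_neg in H1, H2. apply holds_consistent.
    apply (holds_prv2 _ _ _ (proj2 (holds_and _ _) (conj H1 H2)) H).
    eapply prv_orE; [apply prv_hyp; now right; left|..].
    + eapply prv_impE; [eapply prv_andE1, prv_hyp; now right; left|apply prv_hyp; now left].
    + eapply prv_impE; [eapply prv_andE2, prv_hyp; now right; left|apply prv_hyp; now left].
  - intros [H|H]; apply (holds_prv1 _ _ H);
      [apply prv_orI1|apply prv_orI2]; apply prv_hyp; now left.
Qed.

Lemma holds_inst B : holds (fEx B) <-> exists t, holds (inst t B).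
Proof.
  split.
  - intros [k H]%holds_ex. now exists (tVar k).
  - intros [t H]. apply (holds_prv1 _ _ H). apply prv_exI with t, prv_hyp. now left.
Qed.

Lemma holds_instS B : holds (fExS B) <-> exists Y, holds (instS Y B).
Proof.
  split.
  - apply holds_exS.
  - intros [t H]. apply (holds_prv1 _ _ H). apply prv_exSI with t, prv_hyp. now left.
Qed.

(** Witnesses are added for existential formulas only; a universal formula that fails gets its
    counterexample from [fEx (fNeg A)]. *)
Lemma prv_not_ex A : prv T [fNeg (fEx (fNeg A))] (fAll A).
Proof.
  apply prv_allI. apply prv_raa. eapply prv_impE; [apply prv_hyp; right; now left|].
  apply prv_exI with (tVar 0). unfold inst. simpl. rewrite fsubst_comp.
  apply prv_hyp. left. unfold fNeg. f_equal.
  rewrite <- (fsubst_id A) at 1. f_equal.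
  apply functional_extensionality; intros [|n]; reflexivity.
Qed.

Lemma prv_not_exS A : prv T [fNeg (fExS (fNeg A))] (fAllS A).
Proof.
  apply prv_allSI. apply prv_raa. eapply prv_impE; [apply prv_hyp; right; now left|].
  apply prv_exSI with 0. unfold instS. simpl. rewrite fsubst_comp.
  apply prv_hyp. left. unfold fNeg. f_equal.
  rewrite <- (fsubst_id A) at 1. f_equal.
  apply functional_extensionality; intros [|n]; reflexivity.
Qed.

Lemma holds_all A : holds (fAll A) <-> forall t, holds (inst t A).
Proof.
  split.
  - intros H t. apply (holds_prv1 _ _ H). apply prv_allE, prv_hyp. now left.
  - intros H. apply (holds_prv1 (fNeg (fEx (fNeg A)))); [|apply prv_not_ex].
    apply holds_neg. rewrite holds_inst. intros [t Ht].
    apply (proj1 (holds_neg (inst t A))); [exact Ht|apply H].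
Qed.

Lemma holds_allS A : holds (fAllS A) <-> forall Y, holds (instS Y A).
Proof.
  split.
  - intros H t. apply (holds_prv1 _ _ H). apply prv_allSE, prv_hyp. now left.
  - intros H. apply (holds_prv1 (fNeg (fExS (fNeg A)))); [|apply prv_not_exS].
    apply holds_neg. rewrite holds_instS. intros [t Ht].
    apply (proj1 (holds_neg (instS t A))); [exact Ht|apply H].
Qed.

Lemma holds_refl t : holds (fEq t t).
Proof. apply holds_prv, prv_refl. Qed.

Lemma holds_rewrite A s t : holds (fEq s t) -> holds (inst s A) -> holds (inst t A).
Proof.
  intros H1 H2. apply (holds_prv2 _ _ _ H1 H2).
  eapply prv_eqE; apply prv_hyp; [now left|now right; left].
Qed.

Lemma tinst_shift t u : tsubst (scons t tVar) (tshift 1 u) = u.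
Proof. unfold tshift. rewrite tsubst_comp. apply tsubst_id. Qed.

Lemma holds_sym s t : holds (fEq s t) -> holds (fEq t s).
Proof.
  intros H.
  generalize (holds_rewrite (fEq (tVar 0) (tshift 1 s)) s t H).
  change (inst ?u (fEq (tVar 0) ?v)) with (fEq u (tsubst (scons u tVar) v)).
  rewrite !tinst_shift. intros H1. apply H1, holds_refl.
Qed.

Lemma holds_trans s t u : holds (fEq s t) -> holds (fEq t u) -> holds (fEq s u).
Proof.
  intros H H2. apply holds_sym in H.
  generalize (holds_rewrite (fEq (tVar 0) (tshift 1 u)) t s H).
  change (inst ?u (fEq (tVar 0) ?v)) with (fEq u (tsubst (scons u tVar) v)).
  rewrite !tinst_shift. auto.
Qed.

Definition holds_eq (s t : term) : Prop := holds (fEq s t).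

Instance holds_eq_equiv : Equivalence holds_eq.
Proof.
  split; [intros t; apply holds_refl|intros s t; apply holds_sym|intros s t u; apply holds_trans].
Qed.

Definition canon_num : Type := quotient holds_eq.

(** Set terms are variables and the language has no equality between sets, so the set variables
    themselves form the second-order part. *)
Definition canon : structure :=
  Structure canon_num (class holds_eq tZero) (class holds_eq tOne)
    (fun x y => class holds_eq (tAdd (proj1_sig x) (proj1_sig y)))
    (fun x y => class holds_eq (tMul (proj1_sig x) (proj1_sig y)))
    (fun x y => holds (fLt (proj1_sig x) (proj1_sig y)))
    nat
    (fun x X => holds (fMem (proj1_sig x) X)).

Lemma holds_rewrite2 (f : term -> term -> form) s s' t t' :
  (forall sigma u v, fsubst sigma (fun X => X) (f u v) = f (tsubst sigma u) (tsubst sigma v)) ->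
  holds (fEq s s') -> holds (fEq t t') -> holds (f s t) -> holds (f s' t').
Proof.
  intros Hf H1 H2 H.
  assert (H3 : holds (f s' t)).
  { generalize (holds_rewrite (f (tVar 0) (tshift 1 t)) s s' H1).
    unfold inst. rewrite !Hf. simpl.
    fold (@scons term s tVar) (@scons term s' tVar). rewrite !tinst_shift. auto. }
  generalize (holds_rewrite (f (tshift 1 s') (tVar 0)) t t' H2).
  unfold inst. rewrite !Hf. simpl.
  fold (@scons term t tVar) (@scons term t' tVar). rewrite !tinst_shift. auto.
Qed.

Lemma holds_congr (g : term -> term -> term) s s' t t' :
  (forall sigma u v, tsubst sigma (g u v) = g (tsubst sigma u) (tsubst sigma v)) ->
  holds (fEq s s') -> holds (fEq t t') -> holds (fEq (g s t) (g s' t')).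
Proof.
  intros Hg H1 H2.
  assert (H3 : holds (fEq (g s t) (g s' t))).
  { generalize (holds_rewrite (fEq (tshift 1 (g s t)) (g (tVar 0) (tshift 1 t))) s s' H1).
    change (inst ?u (fEq ?a ?v)) with (fEq (tsubst (scons u tVar) a) (tsubst (scons u tVar) v)).
    rewrite !tinst_shift, !Hg, !tinst_shift. intros H; apply H, holds_refl. }
  apply holds_trans with (1 := H3).
  generalize (holds_rewrite (fEq (tshift 1 (g s' t)) (g (tshift 1 s') (tVar 0))) t t' H2).
  change (inst ?u (fEq ?a ?v)) with (fEq (tsubst (scons u tVar) a) (tsubst (scons u tVar) v)).
  rewrite !tinst_shift, !Hg, !tinst_shift. intros H; apply H, holds_refl.
Qed.

Lemma eval_canon sigma t : eval canon (fun n => class holds_eq (sigma n)) t = class holds_eq (tsubst sigma t).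
Proof.
  induction t; simpl; auto; rewrite IHt1, IHt2; apply class_eq; simpl;
    (apply holds_congr; [reflexivity|apply holds_sym, (repr_rel holds_eq)..]).
Qed.

(** The truth lemma. Arbitrary substitutions are needed because a quantifier extends [sigma] by any
    term, or [rho] by any set variable. *)
Lemma sat_canon A : forall sigma rho,
  sat canon (fun n => class holds_eq (sigma n)) rho A <-> holds (fsubst sigma rho A).
Proof.
  induction A; intros sigma rho; simpl.
  - split; [easy|]. apply holds_consistent.
  - rewrite !eval_canon. apply class_eq.
  - rewrite !eval_canon. split; apply holds_rewrite2; auto;
      (apply (repr_rel holds_eq) || apply holds_sym, (repr_rel holds_eq)).
  - rewrite !eval_canon. 
    split; apply (holds_rewrite2 (fun u _ => fMem u (rho X)) _ _ tZero tZero); auto;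
      try apply holds_refl; (apply (repr_rel holds_eq) || apply holds_sym, (repr_rel holds_eq)).
  - now rewrite holds_imp, IHA1, IHA2.
  - now rewrite holds_and, IHA1, IHA2.
  - now rewrite holds_or, IHA1, IHA2.
  - rewrite holds_all. split.
    + intros H t. rewrite inst_subst, <- IHA, scons_comp. apply H.
    + intros H x. specialize (H (proj1_sig x)).
      rewrite inst_subst, <- IHA, scons_comp, class_val in H. exact H.
  - rewrite holds_inst. split.
    + intros [x H]. exists (proj1_sig x). rewrite inst_subst, <- IHA, scons_comp, class_val. exact H.
    + intros [t H]. exists (class holds_eq t). rewrite inst_subst, <- IHA, scons_comp in H. exact H.
  - rewrite holds_allS. split; intros H Y; specialize (H Y);
      [rewrite instS_subst, <- IHA|rewrite instS_subst, <- IHA in H]; exact H.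
  - rewrite holds_instS. split; intros [Y H]; exists Y;
      [rewrite instS_subst, <- IHA|rewrite instS_subst, <- IHA in H]; exact H.
Qed.

Lemma canon_models : models canon T.
Proof.
  intros A HA e E.
  replace e with (fun n => class holds_eq (proj1_sig (e n)))
    by (apply functional_extensionality; intros n; apply class_val).
  apply sat_canon. apply holds_prv. now apply HT.
Qed.

Lemma canon_refutes : ~ sat canon (fun n => class holds_eq (tVar n)) (fun X => X) A0.
Proof.
  rewrite sat_canon, fsubst_id. apply holds_neg. exists 0. apply prv_hyp. now left.
Qed.

End Henkin.

Theorem completeness (T : form -> Prop) (A : form) :
  subst_closed T -> (forall M, models M T -> forall e E, sat M e E A) -> proves T A.
Proof.
  intros HT H. apply NNPP. intros HA.
  apply (canon_refutes T HT A HA). apply H. now apply canon_models.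
Qed.

(** * Models of RCA0 and definability *)

Lemma tsubst_up_shift sigma t : tsubst (up sigma) (tshift 1 t) = tshift 1 (tsubst sigma t).
Proof. unfold tshift. now rewrite !tsubst_comp. Qed.

Lemma bounded_subst sigma rho A : bounded A -> bounded (fsubst sigma rho A).
Proof.
  intros H; revert sigma rho; induction H; intros sigma rho; simpl; try (constructor; auto; fail).
  - rewrite tsubst_up_shift. constructor; auto.
  - rewrite tsubst_up_shift. constructor; auto.
Qed.

Lemma Sigma01_subst sigma rho A : Sigma01 A -> Sigma01 (fsubst sigma rho A).
Proof. intros [B HB]. now constructor; apply bounded_subst. Qed.

Lemma Pi01_subst sigma rho A : Pi01 A -> Pi01 (fsubst sigma rho A).
Proof. intros [B HB]. now constructor; apply bounded_subst. Qed.

(** Each scheme is closed under substitution because the substituted matrix stays in its class. A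
    basic axiom is a single open formula in at most two variables; its instances are derived by
    generalizing and instantiating. *)
Lemma RCA0_subst_closed : subst_closed RCA0.
Proof.
  intros A G sigma rho [B HB|B HB|B C HB HC].
  - assert (HN : num_bound B <= 2 /\ set_bound B = 0) by (destruct HB; simpl; lia).
    assert (H : prv RCA0 G (fAll (fAll B))) by (do 2 apply prv_allI; now apply prv_ax, RCA0_basic).
    apply (prv_allE _ _ _ (sigma 1)) in H. apply (prv_allE _ _ _ (sigma 0)) in H.
    rewrite inst_subst in H.
    replace (fsubst sigma rho B) with
      (fsubst (scons (sigma 0) (fun n => match n with 0 => sigma 1 | S n => tVar n end)) (fun X => X) B);
      [exact H|].
    apply fsubst_agree; [|lia]. intros [|[|n]] Hn; [reflexivity..|lia].
  - apply prv_ax. replace (fsubst _ _ _) with (induction (fsubst (up sigma) rho B)).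
    + now apply RCA0_induction, Sigma01_subst.
    + unfold induction. simpl. rewrite inst_subst, subst_inst, !fsubst_comp.
      repeat f_equal. apply functional_extensionality; intros [|n]; [reflexivity|].
      simpl. unfold tshift. rewrite tsubst_comp. reflexivity.
  - apply prv_ax. unfold comprehension. simpl. rewrite shiftS_subst.
    apply RCA0_comprehension; [now apply Sigma01_subst|now apply Pi01_subst].
Qed.

Lemma eval_subst M e sigma t : eval M e (tsubst sigma t) = eval M (fun n => eval M e (sigma n)) t.
Proof. induction t; simpl; congruence. Qed.

Lemma eval_shift M x e t : eval M (scons x e) (tshift 1 t) = eval M e t.
Proof. unfold tshift. now rewrite eval_subst. Qed.

Lemma eval_up M x e sigma :
  (fun n => eval M (scons x e) (up sigma n)) = scons x (fun n => eval M e (sigma n)).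
Proof.
  apply functional_extensionality; intros [|n]; [reflexivity|]. apply eval_shift.
Qed.

Lemma scons_upS T (Y : T) E rho :
  (fun X => scons Y E (upS rho X)) = scons Y (fun X => E (rho X)).
Proof. apply functional_extensionality; intros [|n]; reflexivity. Qed.

Lemma sat_subst M A : forall sigma rho e E,
  sat M e E (fsubst sigma rho A) <-> sat M (fun n => eval M e (sigma n)) (fun X => E (rho X)) A.
Proof.
  induction A; intros sigma rho e E; simpl; rewrite ?eval_subst; try tauto.
  - now rewrite IHA1, IHA2.
  - now rewrite IHA1, IHA2.
  - now rewrite IHA1, IHA2.
  - split; intros H x; specialize (H x); [rewrite IHA, eval_up in H|rewrite IHA, eval_up]; exact H.
  - split; intros [x H]; exists x; [rewrite IHA, eval_up in H|rewrite IHA, eval_up]; exact H.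
  - split; intros H x; specialize (H x); [rewrite IHA, scons_upS in H|rewrite IHA, scons_upS]; exact H.
  - split; intros [x H]; exists x; [rewrite IHA, scons_upS in H|rewrite IHA, scons_upS]; exact H.
Qed.

(** Interleaves two environments, so that two formulas with parameters of their own can be read in a
    common one, the first on the even variables and the second on the odd ones. *)
Definition merge {T : Type} (f g : nat -> T) (n : nat) : T :=
  if Nat.even n then f (Nat.div2 n) else g (Nat.div2 n).

Lemma merge_even T (f g : nat -> T) n : merge f g (2 * n) = f n.
Proof. unfold merge. rewrite Nat.even_mul. simpl orb. cbv iota. now rewrite Nat.div2_double. Qed.

Lemma merge_odd T (f g : nat -> T) n : merge f g (S (2 * n)) = g n.
Proof.
  unfold merge. rewrite Nat.even_succ, Nat.odd_mul. simpl andb. cbv iota.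
  now rewrite Nat.div2_succ_double.
Qed.

(** [rca_set] fills irrelevant positions of a set environment; a structure alone might have no set
    at all. *)
Record rca_model : Type := RcaModel {
  carrier :> structure;
  rca_models : models carrier RCA0;
  rca_set : mset carrier }.

Section Definability.
Context {M : rca_model}.
Local Notation N := (num M).
Local Notation env := (nat -> N).

(** A wiring sends each variable of a formula to a position of the environment
    or to an element of the model, so that parameters need no environment slot. *)
Definition wire (w : nat -> nat + N) (e : env) (i : nat) : N :=
  match w i with inl n => e n | inr c => c end.

(** Terms, bounded formulas and Sigma01 formulas are treated as classes of functions and predicates
    on environments. Membership in a class can then be checked by tactics on Rocq propositions
    instead of on de Bruijn syntax. *)
Definition TM (f : env -> N) : Prop :=
  exists t w, forall e, f e = eval M (wire w e) t.

Definition D0 (P : env -> Prop) : Prop :=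
  exists A E w, bounded A /\ forall e, P e <-> sat M (wire w e) E A.

Definition S1 (P : env -> Prop) : Prop :=
  exists Q : N -> env -> Prop,
    D0 (fun e => Q (e 0) (fun n => e (S n))) /\ forall e, P e <-> exists x, Q x e.

Definition evens (n : nat) : nat := 2 * n.
Definition odds (n : nat) : nat := S (2 * n).

Lemma wire_merge_even w1 w2 e : (fun n => wire (merge w1 w2) e (evens n)) = wire w1 e.
Proof. apply functional_extensionality; intros n. unfold wire, evens. now rewrite merge_even. Qed.

Lemma wire_merge_odd w1 w2 e : (fun n => wire (merge w1 w2) e (odds n)) = wire w2 e.
Proof. apply functional_extensionality; intros n. unfold wire, odds. now rewrite merge_odd. Qed.

Definition left_form (A : form) : form := fsubst (fun n => tVar (evens n)) evens A.
Definition right_form (A : form) : form := fsubst (fun n => tVar (odds n)) odds A.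

Lemma sat_left A w1 w2 E1 E2 e :
  sat M (wire (merge w1 w2) e) (merge E1 E2) (left_form A) <-> sat M (wire w1 e) E1 A.
Proof.
  unfold left_form. rewrite sat_subst. simpl. rewrite wire_merge_even.
  replace (fun X => merge E1 E2 (evens X)) with E1; [reflexivity|].
  apply functional_extensionality; intros n. symmetry. apply merge_even.
Qed.

Lemma sat_right A w1 w2 E1 E2 e :
  sat M (wire (merge w1 w2) e) (merge E1 E2) (right_form A) <-> sat M (wire w2 e) E2 A.
Proof.
  unfold right_form. rewrite sat_subst. simpl. rewrite wire_merge_odd.
  replace (fun X => merge E1 E2 (odds X)) with E2; [reflexivity|].
  apply functional_extensionality; intros n. symmetry. apply merge_odd.
Qed.

Lemma eval_left t w1 w2 e :
  eval M (wire (merge w1 w2) e) (tsubst (fun n => tVar (evens n)) t) = eval M (wire w1 e) t.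
Proof. rewrite eval_subst. simpl. now rewrite wire_merge_even. Qed.

Lemma eval_right t w1 w2 e :
  eval M (wire (merge w1 w2) e) (tsubst (fun n => tVar (odds n)) t) = eval M (wire w2 e) t.
Proof. rewrite eval_subst. simpl. now rewrite wire_merge_odd. Qed.

(** A wiring may send several variables to position 0; all of them become the variable 0 that a
    quantifier is about to bind. *)
Definition bind_var (w : nat -> nat + N) (i : nat) : term :=
  match w i with inl 0 => tVar 0 | _ => tVar (S i) end.

(** The value at [inl 0] is a dummy: the variable [S i] for such an [i] does not occur after
    [bind]. *)
Definition bind_wiring (w : nat -> nat + N) (i : nat) : nat + N :=
  match w i with inl (S n) => inl n | inl 0 => inl 0 | inr c => inr c end.

Definition bind (w : nat -> nat + N) : form -> form := fsubst (bind_var w) (fun X => X).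

Lemma sat_bind A E w x e :
  sat M (wire w (scons x e)) E A <-> sat M (scons x (wire (bind_wiring w) e)) E (bind w A).
Proof.
  unfold bind. rewrite sat_subst.
  replace (fun n => eval M _ (bind_var w n)) with (wire w (scons x e)); [reflexivity|].
  apply functional_extensionality; intros i. unfold wire, bind_wiring, bind_var.
  destruct (w i) as [[|n]|c] eqn:Hw; simpl; rewrite ?Hw; reflexivity.
Qed.

Lemma TM_var n : TM (fun e => e n).
Proof. exists (tVar 0), (fun _ => inl n). reflexivity. Qed.

Lemma TM_const c : TM (fun _ => c).
Proof. exists (tVar 0), (fun _ => inr c). reflexivity. Qed.

Lemma TM_add f g : TM f -> TM g -> TM (fun e => madd M (f e) (g e)).
Proof.
  intros (t1 & w1 & H1) (t2 & w2 & H2).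
  exists (tAdd (tsubst (fun n => tVar (evens n)) t1) (tsubst (fun n => tVar (odds n)) t2)), (merge w1 w2).
  intros e. simpl. rewrite eval_left, eval_right. congruence.
Qed.

Lemma TM_mul f g : TM f -> TM g -> TM (fun e => mmul M (f e) (g e)).
Proof.
  intros (t1 & w1 & H1) (t2 & w2 & H2).
  exists (tMul (tsubst (fun n => tVar (evens n)) t1) (tsubst (fun n => tVar (odds n)) t2)), (merge w1 w2).
  intros e. simpl. rewrite eval_left, eval_right. congruence.
Qed.

Lemma TM_common f g : TM f -> TM g ->
  exists s t w, (forall e, f e = eval M (wire w e) s) /\ (forall e, g e = eval M (wire w e) t).
Proof.
  intros (t1 & w1 & H1) (t2 & w2 & H2).
  exists (tsubst (fun n => tVar (evens n)) t1), (tsubst (fun n => tVar (odds n)) t2), (merge w1 w2).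
  split; intros e; [rewrite eval_left|rewrite eval_right]; auto.
Qed.

Lemma D0_ext P Q : (forall e, P e <-> Q e) -> D0 P -> D0 Q.
Proof.
  intros H (A & E & w & HA & HP). exists A, E, w. split; [exact HA|].
  intros e. rewrite <- H. apply HP.
Qed.

Lemma TM_D0_eq f g : TM f -> TM g -> D0 (fun e => f e = g e).
Proof.
  intros Hf Hg. destruct (TM_common f g Hf Hg) as (s & t & w & H1 & H2).
  exists (fEq s t), (fun _ => rca_set M), w. split; [constructor|].
  intros e. simpl. now rewrite H1, H2.
Qed.

Lemma TM_D0_lt f g : TM f -> TM g -> D0 (fun e => mlt M (f e) (g e)).
Proof.
  intros Hf Hg. destruct (TM_common f g Hf Hg) as (s & t & w & H1 & H2).
  exists (fLt s t), (fun _ => rca_set M), w. split; [constructor|].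
  intros e. simpl. now rewrite H1, H2.
Qed.

Lemma TM_D0_mem f X : TM f -> D0 (fun e => mmem M (f e) X).
Proof.
  intros (t & w & H). exists (fMem t 0), (fun _ => X), w. split; [constructor|].
  intros e. simpl. now rewrite H.
Qed.

Lemma D0_common P Q : D0 P -> D0 Q ->
  exists A B E w, bounded A /\ bounded B /\
    (forall e, P e <-> sat M (wire w e) E A) /\ (forall e, Q e <-> sat M (wire w e) E B).
Proof.
  intros (A & E1 & w1 & HA & HP) (B & E2 & w2 & HB & HQ).
  exists (left_form A), (right_form B), (merge E1 E2), (merge w1 w2).
  split; [now apply bounded_subst|]. split; [now apply bounded_subst|].
  split; intros e; [rewrite sat_left|rewrite sat_right]; auto.
Qed.

Lemma D0_imp P Q : D0 P -> D0 Q -> D0 (fun e => P e -> Q e).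
Proof.
  intros HP HQ. destruct (D0_common P Q HP HQ) as (A & B & E & w & HA & HB & H1 & H2).
  exists (fImp A B), E, w. split; [now constructor|]. intros e. simpl. now rewrite H1, H2.
Qed.

Lemma D0_and P Q : D0 P -> D0 Q -> D0 (fun e => P e /\ Q e).
Proof.
  intros HP HQ. destruct (D0_common P Q HP HQ) as (A & B & E & w & HA & HB & H1 & H2).
  exists (fAnd A B), E, w. split; [now constructor|]. intros e. simpl. now rewrite H1, H2.
Qed.

Lemma D0_or P Q : D0 P -> D0 Q -> D0 (fun e => P e \/ Q e).
Proof.
  intros HP HQ. destruct (D0_common P Q HP HQ) as (A & B & E & w & HA & HB & H1 & H2).
  exists (fOr A B), E, w. split; [now constructor|]. intros e. simpl. now rewrite H1, H2.
Qed.

Lemma D0_False : D0 (fun _ => False).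
Proof. exists fBot, (fun _ => rca_set M), inl. split; [constructor|reflexivity]. Qed.

Lemma D0_not P : D0 P -> D0 (fun e => ~ P e).
Proof. intros H. apply (D0_imp P (fun _ => False)); [exact H|apply D0_False]. Qed.

Lemma D0_iff P Q : D0 P -> D0 Q -> D0 (fun e => P e <-> Q e).
Proof. intros HP HQ. apply D0_and; apply D0_imp; assumption. Qed.

Lemma D0_bind P : D0 P -> exists A E w, bounded A /\
  forall x e, P (scons x e) <-> sat M (scons x (wire w e)) E A.
Proof.
  intros (A & E & w & HA & HP). exists (bind w A), E, (bind_wiring w).
  split; [now apply bounded_subst|]. intros x e. now rewrite HP, sat_bind.
Qed.

Lemma D0_bind_common f P : TM f -> D0 P -> exists t A E w, bounded A /\
  (forall e, f e = eval M (wire w e) t) /\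
  forall x e, P (scons x e) <-> sat M (scons x (wire w e)) E A.
Proof.
  intros (t & w1 & Hf) HP. destruct (D0_bind P HP) as (A & E & w2 & HA & HP').
  exists (tsubst (fun n => tVar (evens n)) t), (fsubst (up (fun n => tVar (odds n))) (fun X => X) A), E, (merge w1 w2).
  split; [now apply bounded_subst|]. split; intros; [now rewrite eval_left|].
  rewrite HP', sat_subst, eval_up. simpl. now rewrite wire_merge_odd.
Qed.

Lemma D0_ball f (P : N -> env -> Prop) :
  TM f -> D0 (fun e => P (e 0) (fun n => e (S n))) ->
  D0 (fun e => forall x, mlt M x (f e) -> P x e).
Proof.
  intros Hf HP. destruct (D0_bind_common f _ Hf HP) as (t & A & E & w & HA & H1 & H2).
  exists (fAll (fImp (fLt (tVar 0) (tshift 1 t)) A)), E, w. split; [now constructor|].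
  intros e. simpl. setoid_rewrite eval_shift. setoid_rewrite <- H2. setoid_rewrite <- H1.
  reflexivity.
Qed.

Lemma D0_bex f (P : N -> env -> Prop) :
  TM f -> D0 (fun e => P (e 0) (fun n => e (S n))) ->
  D0 (fun e => exists x, mlt M x (f e) /\ P x e).
Proof.
  intros Hf HP. destruct (D0_bind_common f _ Hf HP) as (t & A & E & w & HA & H1 & H2).
  exists (fEx (fAnd (fLt (tVar 0) (tshift 1 t)) A)), E, w. split; [now constructor|].
  intros e. simpl. setoid_rewrite eval_shift. setoid_rewrite <- H2. setoid_rewrite <- H1.
  reflexivity.
Qed.

Lemma D0_rewire (P : env -> Prop) (xi : nat -> nat + N) :
  D0 P -> D0 (fun e => P (wire xi e)).
Proof.
  intros (A & E & w & HA & HP).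
  exists A, E, (fun i => match w i with inl n => xi n | inr c => inr c end).
  split; [exact HA|]. intros e. rewrite HP.
  replace (wire w (wire xi e)) with (wire (fun i => match w i with inl n => xi n | inr c => inr c end) e);
    [reflexivity|].
  apply functional_extensionality; intros i. unfold wire. now destruct (w i).
Qed.

Lemma D0_rename P (xi : nat -> nat) : D0 P -> D0 (fun e => P (fun n => e (xi n))).
Proof. exact (D0_rewire P (fun n => inl (xi n))). Qed.

Lemma S1_form P : S1 P <->
  exists A E w, bounded A /\ forall e, P e <-> sat M (wire w e) E (fEx A).
Proof.
  split.
  - intros (Q & HQ & HP). destruct (D0_bind _ HQ) as (A & E & w & HA & H).
    exists A, E, w. split; [exact HA|]. intros e. rewrite HP. simpl. setoid_rewrite <- H. reflexivity.
  - intros (A & E & w & HA & HP). exists (fun x e => sat M (scons x (wire w e)) E A).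
    split; [|exact HP].
    exists A, E, (fun i => match i with 0 => inl 0 | S i => match w i with inl n => inl (S n) | inr c => inr c end end).
    split; [exact HA|]. intros e.
    replace (wire _ e) with (scons (e 0) (wire w (fun n => e (S n)))); [reflexivity|].
    apply functional_extensionality; intros [|i]; [reflexivity|]. unfold wire. simpl. now destruct (w i).
Qed.

Lemma S1_induction (P : N -> Prop) :
  S1 (fun e => P (e 0)) -> P (mzero M) ->
  (forall x, P x -> P (madd M x (mone M))) -> forall x, P x.
Proof.
  intros (A & E & w & HA & HP)%S1_form H0 HS.
  set (e := fun _ : nat => mzero M).
  assert (HB : forall x, P x <-> sat M (scons x (wire (bind_wiring w) e)) E (bind w (fEx A))).
  { intros x. rewrite (HP (scons x e)). apply sat_bind. }
  assert (HI := rca_models M (induction (bind w (fEx A)))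
    (RCA0_induction _ (Sigma01_subst _ _ _ (Sigma01_ex _ HA))) (wire (bind_wiring w) e) E).
  unfold induction in HI. change (sat M (wire (bind_wiring w) e) E (inst tZero (bind w (fEx A))) /\
    (forall x, sat M (scons x (wire (bind_wiring w) e)) E (bind w (fEx A)) ->
       sat M (scons x (wire (bind_wiring w) e)) E
         (fsubst (fun n => match n with 0 => tAdd (tVar 0) tOne | S n => tVar (S n) end) (fun X => X) (bind w (fEx A)))) ->
     forall x, sat M (scons x (wire (bind_wiring w) e)) E (bind w (fEx A))) in HI.
  intros x. apply HB. apply HI. split.
  - unfold inst. rewrite sat_subst.
    replace (fun n : nat => eval M _ _) with (scons (mzero M) (wire (bind_wiring w) e));
      [now apply HB|].
    apply functional_extensionality; intros [|n]; reflexivity.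
  - intros y Hy. rewrite sat_subst.
    replace (fun n : nat => eval M _ _) with (scons (madd M y (mone M)) (wire (bind_wiring w) e));
      [now apply HB, HS, HB|].
    apply functional_extensionality; intros [|n]; reflexivity.
Qed.

(** [merge] puts the parameters of both Sigma01 definitions into one environment; the negation of
    the second is the Pi01 definition that the axiom asks for. *)
Lemma delta_comprehension (P : N -> Prop) :
  S1 (fun e => P (e 0)) -> S1 (fun e => ~ P (e 0)) -> exists X, forall x, mmem M x X <-> P x.
Proof.
  intros (A & E1 & w1 & HA & HP)%S1_form (B & E2 & w2 & HB & HQ)%S1_form.
  set (e := fun _ : nat => mzero M). set (w := merge w1 w2). set (E := merge E1 E2).
  set (A' := bind w (left_form (fEx A))). set (B' := bind w (right_form (fAll (fNeg B)))).
  assert (H1 : forall x, P x <-> sat M (scons x (wire (bind_wiring w) e)) E A').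
  { intros x. rewrite (HP (scons x e)). unfold A'. rewrite <- sat_bind. symmetry. apply sat_left. }
  assert (H2 : forall x, P x <-> sat M (scons x (wire (bind_wiring w) e)) E B').
  { intros x. unfold B'. rewrite <- sat_bind. unfold w, E. rewrite sat_right.
    assert (H := HQ (scons x e)). simpl in H. simpl. split.
    - intros HPx y Hy. apply H; [now exists y|exact HPx].
    - intros Hn. apply NNPP. intros HPx. apply H in HPx as [y Hy]. now apply (Hn y). }
  assert (HC := rca_models M _ (RCA0_comprehension A' B'
    (Sigma01_subst _ _ _ (Sigma01_subst _ _ _ (Sigma01_ex _ HA)))
    (Pi01_subst _ _ _ (Pi01_subst _ _ _ (Pi01_all _ (bounded_imp _ _ HB bounded_bot))))) (wire (bind_wiring w) e) E).
  destruct HC as [X HX].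
  - intros x. split; intros H; [now apply H2, H1|now apply H1, H2].
  - exists X. intros x. rewrite H1. specialize (HX x). 
    unfold shiftS in HX. split; intros H.
    + apply (proj1 HX) in H. rewrite sat_subst in H. exact H.
    + apply (proj2 HX). rewrite sat_subst. exact H.
Qed.

Lemma D0_S1 P : D0 P -> S1 P.
Proof.
  intros H. exists (fun _ => P). split; [exact (D0_rename P S H)|].
  intros e. split; [intros HP; now exists (mzero M)|now intros [_ HP]].
Qed.

Lemma D0_induction (P : N -> Prop) :
  D0 (fun e => P (e 0)) -> P (mzero M) ->
  (forall x, P x -> P (madd M x (mone M))) -> forall x, P x.
Proof. intros H. now apply S1_induction, D0_S1. Qed.
End Definability.

Ltac definable_user := fail.

Ltac definable :=
  cbv beta;
  lazymatch goal with
  | |- TM (fun e => madd _ _ _) => apply TM_add; definable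
  | |- TM (fun e => mmul _ _ _) => apply TM_mul; definable
  | |- TM (fun e => e ?n) => apply TM_var
  | |- TM (fun e => _) => apply TM_const
  | |- D0 (fun e => _ = _) => apply TM_D0_eq; definable
  | |- D0 (fun e => mlt _ _ _) => apply TM_D0_lt; definable
  | |- D0 (fun e => mmem _ _ _) => apply TM_D0_mem; definable
  | |- D0 (fun e => _ /\ _) => apply D0_and; definable
  | |- D0 (fun e => _ \/ _) => apply D0_or; definable
  | |- D0 (fun e => _ <-> _) => apply D0_iff; definable
  | |- D0 (fun e => ~ _) => apply D0_not; definable
  | |- D0 (fun e => False) => apply D0_False
  | |- D0 (fun e => forall x, mlt _ x _ -> _) => apply D0_ball; definable
  | |- D0 (fun e => exists x, mlt _ x _ /\ _) => apply D0_bex; definable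
  | |- D0 (fun e => _ -> _) => apply D0_imp; definable
  | |- _ => assumption || (definable_user; definable)
  end.

(** * Arithmetic in a model *)

Section Arithmetic.
Context {M : rca_model}.
Local Notation N := (num M).
Local Notation "0" := (mzero M).
Local Notation "1" := (mone M).
Local Infix "+" := (madd M).
Local Infix "*" := (mmul M).
Local Infix "<" := (mlt M).

Let basic A (H : basic_axiom A) e := rca_models M A (RCA0_basic A H) e (fun _ => rca_set M).

Lemma succ_neq_0 x : x + 1 <> 0.
Proof. exact (basic _ ax_succ_zero (fun _ => x)). Qed.

Lemma succ_inj x y : x + 1 = y + 1 -> x = y.
Proof. exact (basic _ ax_succ_inj (scons x (fun _ => y))). Qed.

Lemma add_0_r x : x + 0 = x.
Proof. exact (basic _ ax_add_zero (fun _ => x)). Qed.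

Lemma add_succ_r x y : x + (y + 1) = x + y + 1.
Proof. exact (basic _ ax_add_succ (scons x (fun _ => y))). Qed.

Lemma mul_0_r x : x * 0 = 0.
Proof. exact (basic _ ax_mul_zero (fun _ => x)). Qed.

Lemma mul_succ_r x y : x * (y + 1) = x * y + x.
Proof. exact (basic _ ax_mul_succ (scons x (fun _ => y))). Qed.

Lemma nlt_0_r x : ~ x < 0.
Proof. exact (basic _ ax_lt_zero (fun _ => x)). Qed.

Lemma lt_succ_r x y : x < y + 1 <-> x < y \/ x = y.
Proof. exact (basic _ ax_lt_succ (scons x (fun _ => y))). Qed.

Ltac ind x := pattern x; revert x; apply D0_induction; [definable|..].

Lemma add_assoc x y z : x + (y + z) = x + y + z.
Proof.
  ind z; [now rewrite !add_0_r|]. intros z IH. now rewrite !add_succ_r, IH.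
Qed.

Lemma add_0_l x : 0 + x = x.
Proof. ind x; [apply add_0_r|]. intros x IH. now rewrite add_succ_r, IH. Qed.

Lemma add_succ_l x y : x + 1 + y = x + y + 1.
Proof.
  ind y; [now rewrite !add_0_r|]. intros y IH. now rewrite !add_succ_r, IH.
Qed.

Lemma add_comm x y : x + y = y + x.
Proof.
  ind y; [now rewrite add_0_l, add_0_r|]. intros y IH. now rewrite add_succ_r, add_succ_l, IH.
Qed.

Lemma mul_0_l x : 0 * x = 0.
Proof. ind x; [apply mul_0_r|]. intros x IH. now rewrite mul_succ_r, IH, add_0_r. Qed.

Lemma mul_succ_l x y : (x + 1) * y = x * y + y.
Proof.
  ind y; [now rewrite !mul_0_r, add_0_r|]. intros y IH.
  rewrite !mul_succ_r, IH, <- !add_assoc. f_equal. rewrite !add_assoc. f_equal. apply add_comm.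
Qed.

Lemma mul_comm x y : x * y = y * x.
Proof.
  ind y; [now rewrite mul_0_l, mul_0_r|]. intros y IH. now rewrite mul_succ_r, mul_succ_l, IH.
Qed.

Lemma mul_add_r x y z : x * (y + z) = x * y + x * z.
Proof.
  ind z; [now rewrite mul_0_r, !add_0_r|]. intros z IH.
  now rewrite add_succ_r, !mul_succ_r, IH, add_assoc.
Qed.

Lemma mul_add_l x y z : (x + y) * z = x * z + y * z.
Proof. now rewrite mul_comm, mul_add_r, (mul_comm z), (mul_comm z). Qed.

Lemma mul_assoc x y z : x * (y * z) = x * y * z.
Proof.
  ind z; [now rewrite !mul_0_r|]. intros z IH. now rewrite !mul_succ_r, mul_add_r, IH.
Qed.

Lemma mul_1_l x : 1 * x = x.
Proof. now rewrite <- (add_0_l 1), mul_succ_l, mul_0_l, add_0_l. Qed.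

Lemma add_cancel_r x y z : x + z = y + z -> x = y.
Proof.
  ind z; [now rewrite !add_0_r|]. intros z IH H. rewrite !add_succ_r in H.
  now apply IH, succ_inj.
Qed.

Lemma lt_add_succ x z : x < x + z + 1.
Proof.
  ind z; [apply lt_succ_r; right; symmetry; apply add_0_r|].
  intros z IH. apply lt_succ_r. left. now rewrite add_succ_r.
Qed.

(** No order facts are available yet to bound [z], hence Sigma01 induction. The quantifier over [z]
    is moved in front of the implication to reach the form that [S1] prescribes. *)
Lemma lt_exists x y : x < y <-> exists z, y = x + z + 1.
Proof.
  split.
  - pattern y; revert y; apply S1_induction.
    + exists (fun z e => x < e 0%nat -> e 0%nat = x + z + 1). split; [definable|].
      intros e. split; [|intros [z Hz] H; exists z; auto].
      intros H. destruct (classic (x < e 0%nat)) as [Hx|Hx]; [|now exists 0].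
      destruct (H Hx) as [z Hz]. now exists z.
    + intros H. now apply nlt_0_r in H.
    + intros y IH [H| ->]%lt_succ_r.
      * destruct (IH H) as [z ->]. exists (z + 1). now rewrite add_succ_r.
      * exists 0. now rewrite add_0_r.
  - intros [z ->]. apply lt_add_succ.
Qed.

Lemma lt_trichotomy x y : x < y \/ x = y \/ y < x.
Proof.
  ind y.
  - assert (H : x = 0 \/ 0 < x); [|tauto].
    ind x; [now left|]. intros x _. right. apply lt_exists. exists x. now rewrite add_0_l.
  - intros y [H|[ ->|[z ->]%lt_exists]].
    + left. apply lt_succ_r. now left.
    + left. apply lt_succ_r. now right.
    + assert (Hz : z = 0 \/ 0 < z).
      { ind z; [now left|]. intros z _. right. apply lt_exists. exists z. now rewrite add_0_l. }
      destruct Hz as [->|[u ->]%lt_exists].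
      * right. left. now rewrite add_0_r.
      * right. right. apply lt_exists. exists u.
        now rewrite add_0_l, add_succ_r, (add_succ_l y u).
Qed.

Lemma add_eq_0 x z : x + z + 1 <> x.
Proof.
  intros H. apply (succ_neq_0 z). apply add_cancel_r with x.
  now rewrite add_0_l, add_comm, add_assoc.
Qed.

Lemma succ_or_0 x : x = 0 \/ exists y, x = y + 1.
Proof.
  destruct (lt_trichotomy 0 x) as [[z ->]%lt_exists|[<-|H]].
  - right. exists z. now rewrite add_0_l.
  - now left.
  - now apply nlt_0_r in H.
Qed.

Lemma num_srt : semi_ring_theory 0 1 (madd M) (mmul M) (@eq N).
Proof.
  constructor.
  - apply add_0_l.
  - apply add_comm.
  - apply add_assoc.
  - apply mul_1_l.
  - apply mul_0_l.
  - apply mul_comm.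
  - apply mul_assoc.
  - apply mul_add_l.
Qed.
End Arithmetic.

(** * The ordered ring of differences *)

Section Differences.
Context {M : rca_model}.
Local Notation N := (num M).
Local Notation "0" := (mzero M).
Local Notation "1" := (mone M).
Local Infix "+" := (madd M).
Local Infix "*" := (mmul M).
Local Infix "<" := (mlt M).

Add Ring num_ring : (@num_srt M).

(** The pair [(a, b)] stands for [a - b]. Passing to an ordered ring opens the arithmetic of the
    model to [lra]. *)
Definition diff_eq (p q : N * N) : Prop := fst p + snd q = fst q + snd p.

Instance diff_eq_equiv : Equivalence diff_eq.
Proof.
  unfold diff_eq. split.
  - intros [a b]. reflexivity.
  - intros [a b] [c d] H. symmetry. exact H.
  - intros [a b] [c d] [x y]; simpl; intros H1 H2. apply add_cancel_r with (c + d).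
    transitivity (a + d + (c + y)); [ring|]. rewrite H1, H2. ring.
Qed.

Definition diff_class (p : N * N) : quotient diff_eq := class diff_eq p.

Lemma diff_class_eq a b c d : diff_class (a, b) = diff_class (c, d) <-> a + d = c + b.
Proof. exact (class_eq diff_eq (a, b) (c, d)). Qed.

Lemma diff_class_surj (z : quotient diff_eq) : exists a b, z = diff_class (a, b).
Proof. exists (fst (proj1_sig z)), (snd (proj1_sig z)). rewrite <- surjective_pairing. symmetry. apply class_val. Qed.

Definition lift2 (f : N * N -> N * N -> N * N) (x y : quotient diff_eq) : quotient diff_eq :=
  diff_class (f (proj1_sig x) (proj1_sig y)).

Definition diff_add : quotient diff_eq -> quotient diff_eq -> quotient diff_eq :=
  lift2 (fun p q => (fst p + fst q, snd p + snd q)).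
Definition diff_mul : quotient diff_eq -> quotient diff_eq -> quotient diff_eq :=
  lift2 (fun p q => (fst p * fst q + snd p * snd q, fst p * snd q + snd p * fst q)).
Definition diff_opp (x : quotient diff_eq) : quotient diff_eq :=
  diff_class (snd (proj1_sig x), fst (proj1_sig x)).
Definition diff_lt (x y : quotient diff_eq) : Prop :=
  fst (proj1_sig x) + snd (proj1_sig y) < fst (proj1_sig y) + snd (proj1_sig x).

Lemma diff_class_val a b :
  fst (proj1_sig (diff_class (a, b))) + b = a + snd (proj1_sig (diff_class (a, b))).
Proof. symmetry. apply (repr_rel diff_eq (a, b)). Qed.

Lemma diff_addE a b c d : diff_add (diff_class (a, b)) (diff_class (c, d)) = diff_class (a + c, b + d).
Proof.
  apply diff_class_eq. generalize (diff_class_val a b), (diff_class_val c d).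
  set (p := proj1_sig _). set (q := proj1_sig (diff_class (c, d))). intros H1 H2.
  transitivity (fst p + b + (fst q + d)); [ring|]. rewrite H1, H2. ring.
Qed.

Lemma diff_mulE a b c d :
  diff_mul (diff_class (a, b)) (diff_class (c, d)) = diff_class (a * c + b * d, a * d + b * c).
Proof.
  apply diff_class_eq. generalize (diff_class_val a b), (diff_class_val c d).
  set (p := proj1_sig _). set (q := proj1_sig (diff_class (c, d))).
  destruct p as [x y], q as [z w]. simpl. intros H1 H2.
  apply add_cancel_r with (b * z + a * w + a * z + b * w).
  transitivity ((x + b) * z + (a + y) * w + a * (z + d) + b * (c + w)); [ring|].
  transitivity ((a + y) * z + (x + b) * w + a * (c + w) + b * (z + d)); [|ring].
  now rewrite H1, H2.
Qed.

Lemma diff_oppE a b : diff_opp (diff_class (a, b)) = diff_class (b, a).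
Proof.
  apply diff_class_eq. generalize (diff_class_val a b). 
  set (p := proj1_sig _). intros H. rewrite (add_comm b), H. ring.
Qed.

Lemma lt_add_r x y z : x + z < y + z <-> x < y.
Proof.
  rewrite !lt_exists. split; intros [u Hu]; exists u.
  - apply add_cancel_r with z. rewrite Hu. ring.
  - rewrite Hu. ring.
Qed.

Lemma lt_irrefl x : ~ x < x.
Proof. intros [z Hz]%lt_exists. symmetry in Hz. now apply add_eq_0 in Hz. Qed.

Lemma lt_trans x y z : x < y -> y < z -> x < z.
Proof.
  rewrite !lt_exists. intros [u ->] [v ->]. exists (u + v + 1). ring.
Qed.

Lemma diff_ltE a b c d : diff_lt (diff_class (a, b)) (diff_class (c, d)) <-> a + d < c + b.
Proof.
  unfold diff_lt. generalize (diff_class_val a b), (diff_class_val c d).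
  set (p := proj1_sig _). set (q := proj1_sig (diff_class (c, d))). intros H1 H2.
  rewrite <- (lt_add_r _ _ (b + c)).
  rewrite <- (lt_add_r (a + d) _ (fst p + snd q)).
  replace (fst p + snd q + (b + c)) with (fst p + b + (c + snd q)) by ring.
  replace (fst q + snd p + (b + c)) with (fst q + snd p + b + c) by ring.
  rewrite H1, <- H2.
  replace (a + snd p + (fst q + d)) with (a + d + (snd p + fst q)) by ring.
  replace (fst q + snd p + b + c) with (c + b + (snd p + fst q)) by ring.
  now rewrite !lt_add_r.
Qed.

Lemma mul_pos x y : 0 < x -> 0 < y -> 0 < x * y.
Proof.
  rewrite !lt_exists. intros [u ->] [v ->]. exists (u * v + u + v). ring.
Qed.

Definition diff_of (x : N) : quotient diff_eq := diff_class (x, 0).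

Lemma diff_of_add x y : diff_of (x + y) = diff_add (diff_of x) (diff_of y).
Proof. unfold diff_of. rewrite diff_addE. f_equal. f_equal. ring. Qed.

Lemma diff_of_mul x y : diff_of (x * y) = diff_mul (diff_of x) (diff_of y).
Proof. unfold diff_of. rewrite diff_mulE. f_equal. f_equal; ring. Qed.

Lemma diff_of_eq x y : x = y <-> diff_of x = diff_of y.
Proof. unfold diff_of. rewrite diff_class_eq, !add_0_r. reflexivity. Qed.

Lemma diff_of_lt x y : x < y <-> diff_lt (diff_of x) (diff_of y).
Proof. unfold diff_of. rewrite diff_ltE, !add_0_r. reflexivity. Qed.

Lemma diff_mul_eq_0 x y : diff_mul x y = diff_of 0 -> x = diff_of 0 \/ y = diff_of 0.
Proof.
  destruct (diff_class_surj x) as (a & b & ->), (diff_class_surj y) as (c & d & ->).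
  unfold diff_of. rewrite diff_mulE, !diff_class_eq.
  rewrite !add_0_r, !add_0_l. intros H.
  destruct (lt_trichotomy a b) as [[u ->]%lt_exists|[Hab|[u ->]%lt_exists]]; [|now left|];
    (destruct (lt_trichotomy c d) as [[v ->]%lt_exists|[Hcd|[v ->]%lt_exists]]; [|now right|]);
    exfalso.
  (* In each of the four sign cases both factors are nonzero by a successor, and cancelling common
     terms leaves [u * v + u + v + 1 = 0]. *)
  - apply (succ_neq_0 (u * v + u + v)), add_cancel_r with (a * (c + v + 1) + (a + u + 1) * c).
    rewrite add_0_l. transitivity (a * c + (a + u + 1) * (c + v + 1)); [ring|exact H].
  - apply (succ_neq_0 (u * v + u + v)), add_cancel_r with (a * (d + v + 1) + (a + u + 1) * d).
    rewrite add_0_l. transitivity (a * d + (a + u + 1) * (d + v + 1)); [ring|symmetry; exact H].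
  - apply (succ_neq_0 (u * v + u + v)), add_cancel_r with ((b + u + 1) * c + b * (c + v + 1)).
    rewrite add_0_l. transitivity ((b + u + 1) * (c + v + 1) + b * c); [ring|symmetry; exact H].
  - apply (succ_neq_0 (u * v + u + v)), add_cancel_r with ((b + u + 1) * d + b * (d + v + 1)).
    rewrite add_0_l. transitivity ((b + u + 1) * (d + v + 1) + b * d); [ring|exact H].
Qed.

Lemma diff_of_1_neq_0 : diff_of 1 <> diff_of 0.
Proof. rewrite <- diff_of_eq. intros H. apply (succ_neq_0 0). now rewrite add_0_l. Qed.

Lemma diff_add_assoc x y z : diff_add x (diff_add y z) = diff_add (diff_add x y) z.
Proof.
  destruct (diff_class_surj x) as (a & b & ->), (diff_class_surj y) as (c & d & ->),
    (diff_class_surj z) as (p & q & ->).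
  rewrite !diff_addE. f_equal. f_equal; ring.
Qed.

Lemma diff_add_comm x y : diff_add x y = diff_add y x.
Proof.
  destruct (diff_class_surj x) as (a & b & ->), (diff_class_surj y) as (c & d & ->).
  rewrite !diff_addE. f_equal. f_equal; ring.
Qed.

Lemma diff_add_0_l x : diff_add (diff_of 0) x = x.
Proof.
  destruct (diff_class_surj x) as (a & b & ->). unfold diff_of.
  rewrite !diff_addE. f_equal. f_equal; ring.
Qed.

Lemma diff_add_opp_l x : diff_add (diff_opp x) x = diff_of 0.
Proof.
  destruct (diff_class_surj x) as (a & b & ->). unfold diff_of.
  rewrite diff_oppE, diff_addE, diff_class_eq. ring.
Qed.

Lemma diff_mul_assoc x y z : diff_mul x (diff_mul y z) = diff_mul (diff_mul x y) z.
Proof.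
  destruct (diff_class_surj x) as (a & b & ->), (diff_class_surj y) as (c & d & ->),
    (diff_class_surj z) as (p & q & ->).
  rewrite !diff_mulE. f_equal. f_equal; ring.
Qed.

Lemma diff_mul_comm x y : diff_mul x y = diff_mul y x.
Proof.
  destruct (diff_class_surj x) as (a & b & ->), (diff_class_surj y) as (c & d & ->).
  rewrite !diff_mulE. f_equal. f_equal; ring.
Qed.

Lemma diff_mul_1_l x : diff_mul (diff_of 1) x = x.
Proof.
  destruct (diff_class_surj x) as (a & b & ->). unfold diff_of.
  rewrite !diff_mulE. f_equal. f_equal; ring.
Qed.

Lemma diff_mul_add_l x y z : diff_mul (diff_add x y) z = diff_add (diff_mul x z) (diff_mul y z).
Proof.
  destruct (diff_class_surj x) as (a & b & ->), (diff_class_surj y) as (c & d & ->),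
    (diff_class_surj z) as (p & q & ->).
  rewrite diff_addE, !diff_mulE, diff_addE. f_equal. f_equal; ring.
Qed.

Lemma diff_lt_add x y : diff_lt (diff_of 0) x -> diff_lt (diff_of 0) y -> diff_lt (diff_of 0) (diff_add x y).
Proof.
  destruct (diff_class_surj x) as (a & b & ->), (diff_class_surj y) as (c & d & ->).
  unfold diff_of. rewrite diff_addE, !diff_ltE, !add_0_l, !add_0_r, !lt_exists.
  intros [u ->] [v ->]. exists (u + v + 1). ring.
Qed.

Lemma diff_lt_mul x y : diff_lt (diff_of 0) x -> diff_lt (diff_of 0) y -> diff_lt (diff_of 0) (diff_mul x y).
Proof.
  destruct (diff_class_surj x) as (a & b & ->), (diff_class_surj y) as (c & d & ->).
  unfold diff_of. rewrite diff_mulE, !diff_ltE, !add_0_l, !add_0_r, !lt_exists.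
  intros [u ->] [v ->]. exists (u * v + u + v). ring.
Qed.

Lemma diff_lt_asym x y : diff_lt x y -> ~ diff_lt y x.
Proof.
  destruct (diff_class_surj x) as (a & b & ->), (diff_class_surj y) as (c & d & ->).
  rewrite !diff_ltE. intros H1 H2. apply (lt_irrefl (a + d)). now apply lt_trans with (c + b).
Qed.

Lemma diff_sub_pos x y : diff_lt (diff_of 0) (diff_add y (diff_opp x)) <-> diff_lt x y.
Proof.
  destruct (diff_class_surj x) as (a & b & ->), (diff_class_surj y) as (c & d & ->).
  unfold diff_of. rewrite diff_oppE, diff_addE, !diff_ltE, add_0_l, add_0_r, (add_comm d a). reflexivity.
Qed.

Lemma diff_lt_total x : x <> diff_of 0 -> diff_lt (diff_of 0) x \/ diff_lt x (diff_of 0).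
Proof.
  destruct (diff_class_surj x) as (a & b & ->).
  unfold diff_of. rewrite diff_class_eq, !diff_ltE, !add_0_l, !add_0_r.
  destruct (lt_trichotomy a b) as [|[|]]; tauto.
Qed.
End Differences.

(** * The differences as an ordered integral domain, and linear arithmetic in the model *)

Module Import DifferenceRing.
Import ssreflect ssrfun ssrbool eqtype ssrnat choice order ssralg ssrnum boolp lra.
Import Order.TTheory GRing.Theory Num.Theory.

Definition diff (M : rca_model) : Type := quotient (@diff_eq M).

HB.instance Definition _ (M : rca_model) := gen_eqMixin (diff M).
HB.instance Definition _ (M : rca_model) := gen_choiceMixin (diff M).
HB.instance Definition _ (M : rca_model) := GRing.isZmodule.Build (diff M)
  (@diff_add_assoc M) (@diff_add_comm M) (@diff_add_0_l M) (@diff_add_opp_l M).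

Lemma diff_one_neq0 (M : rca_model) : (diff_of (mone M) : diff M) != GRing.zero.
Proof. apply/eqP. exact: diff_of_1_neq_0. Qed.

HB.instance Definition _ (M : rca_model) := GRing.Zmodule_isComNzRing.Build (diff M)
  (@diff_mul_assoc M) (@diff_mul_comm M) (@diff_mul_1_l M) (@diff_mul_add_l M)
  (diff_one_neq0 M).

Section Inverse.
Context (M : rca_model).
Local Open Scope ring_scope.

(** The algebraic interface demands a boolean predicate for units and an inverse function; both are
    obtained classically. *)
Definition diff_unit : {pred diff M} := fun x => `[< exists y : diff M, y * x = 1 >].
Definition diff_inv (x : diff M) : diff M :=
  if pselect (exists y : diff M, y * x = 1) is left H then proj1_sig (cid H) else x.

Lemma diff_mulVx : {in diff_unit, left_inverse 1 diff_inv *%R}.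
Proof.
move=> x /asboolP H; rewrite /diff_inv; case: pselect => [H'|//].
exact: (proj2_sig (cid H')).
Qed.

Lemma diff_unitPl (x y : diff M) : y * x = 1 -> diff_unit x.
Proof. by move=> H; apply/asboolP; exists y. Qed.

Lemma diff_inv_out : {in [predC diff_unit], diff_inv =1 id}.
Proof. by move=> x /asboolPn H; rewrite /diff_inv; case: pselect. Qed.
End Inverse.

HB.instance Definition _ (M : rca_model) := GRing.ComNzRing_hasMulInverse.Build (diff M)
  (@diff_mulVx M) (@diff_unitPl M) (@diff_inv_out M).

Lemma diff_integral (M : rca_model) : GRing.integral_domain_axiom (diff M).
Proof. move=> x y /diff_mul_eq_0 [] ->; apply/orP; [left|right]; exact: eqxx. Qed.

HB.instance Definition _ (M : rca_model) :=
  GRing.ComUnitRing_isIntegral.Build (diff M) (@diff_integral M).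

Section Order.
Context (M : rca_model).
Local Open Scope ring_scope.

Definition diff_ltb (x y : diff M) : bool := `[< diff_lt x y >].
Definition diff_leb (x y : diff M) : bool := (x == y) || diff_ltb x y.
Definition diff_norm (x : diff M) : diff M := if diff_ltb x 0 then - x else x.

Lemma diff_ltb_add (x y : diff M) : diff_ltb 0 x -> diff_ltb 0 y -> diff_ltb 0 (x + y).
Proof. move=> /asboolP ? /asboolP ?; apply/asboolP; exact: diff_lt_add. Qed.

Lemma diff_ltb_mul (x y : diff M) : diff_ltb 0 x -> diff_ltb 0 y -> diff_ltb 0 (x * y).
Proof. move=> /asboolP ? /asboolP ?; apply/asboolP; exact: diff_lt_mul. Qed.

Lemma diff_ltb_asym (x : diff M) : diff_ltb 0 x -> ~~ diff_ltb x 0.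
Proof. move=> /asboolP H; apply/asboolP; exact: diff_lt_asym. Qed.

Lemma diff_ltb_sub (x y : diff M) : diff_ltb 0 (y - x) = diff_ltb x y.
Proof. apply: asbool_equiv_eq; exact: diff_sub_pos. Qed.

Lemma diff_ltb_total (x : diff M) : x != 0 -> diff_ltb 0 x || diff_ltb x 0.
Proof. by move=> /eqP /diff_lt_total [H|H]; apply/orP; [left|right]; apply/asboolP. Qed.

Lemma diff_ltb_opp (x : diff M) : diff_ltb (- x) 0 = diff_ltb 0 x.
Proof. by rewrite -diff_ltb_sub sub0r opprK. Qed.

Lemma diff_normN (x : diff M) : diff_norm (- x) = diff_norm x.
Proof.
rewrite /diff_norm diff_ltb_opp opprK.
case: (boolP (diff_ltb 0 x)) => H; first by rewrite (negbTE (diff_ltb_asym _ H)).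
case: (boolP (diff_ltb x 0)) => // H'.
case: (eqVneq x 0) => [->|/diff_ltb_total]; first exact: oppr0.
by rewrite (negbTE H) (negbTE H').
Qed.

Lemma diff_ge0_norm (x : diff M) : diff_leb 0 x -> diff_norm x = x.
Proof.
case/orP => [/eqP <-|/diff_ltb_asym /negbTE H]; rewrite /diff_norm ?H //.
by rewrite oppr0; case: ifP.
Qed.

Lemma diff_leb_def (x y : diff M) : diff_leb x y = (x == y) || diff_ltb x y.
Proof. by []. Qed.
End Order.

HB.instance Definition _ (M : rca_model) := Num.IntegralDomain_isLtReal.Build (diff M)
  (@diff_ltb_add M) (@diff_ltb_mul M) (@diff_ltb_asym M) (@diff_ltb_sub M)
  (@diff_ltb_total M) (@diff_normN M) (@diff_ge0_norm M) (@diff_leb_def M).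

Section Embedding.
Context {M : rca_model}.
Local Open Scope ring_scope.

Definition emb (x : num M) : diff M := diff_of x.

Lemma emb0 : emb (mzero M) = 0. Proof. by []. Qed.
Lemma emb1 : emb (mone M) = 1. Proof. by []. Qed.
Lemma embD x y : emb (madd M x y) = emb x + emb y. Proof. exact: diff_of_add. Qed.
Lemma embM x y : emb (mmul M x y) = emb x * emb y. Proof. exact: diff_of_mul. Qed.
Lemma emb_eq x y : x = y <-> emb x = emb y. Proof. exact: diff_of_eq. Qed.

Lemma emb_lt x y : mlt M x y <-> emb x < emb y.
Proof. rewrite diff_of_lt; split => [H|/asboolP //]; exact/asboolP. Qed.

Lemma emb_ge0 x : 0 <= emb x.
Proof.
rewrite le_eqVlt; apply/orP; case: (succ_or_0 x) => [->|[y ->]]; first by left; apply/eqP.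
by right; apply/emb_lt/lt_succ_r; case: (succ_or_0 y) => [->|[z ->]]; [right|left; apply/lt_exists; exists z; rewrite add_0_l].
Qed.

Fixpoint nm (k : nat) : num M :=
  match k with O => mzero M | S k => madd M (nm k) (mone M) end.

Lemma emb_nm k : emb (nm k) = k%:R.
Proof. by elim: k => //= k IH; rewrite embD IH -[in RHS]addn1 natrD. Qed.

Lemma emb_lt1 x y : mlt M x y <-> emb x + 1 <= emb y.
Proof.
split=> [/lt_exists [z ->]|H]; last by apply/emb_lt; lra.
by rewrite !embD; have := emb_ge0 z; rewrite emb1; lra.
Qed.

Lemma emb_nlt x y : ~ mlt M x y <-> emb y <= emb x.
Proof.
split=> [H|H /emb_lt]; last by lra.
case: (lt_trichotomy x y) => [//|[->|/emb_lt]]; [exact: lexx|exact: ltW].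
Qed.

Lemma emb_absurd : (1 : diff M) <= 0 -> False.
Proof. by lra. Qed.
End Embedding.

#[global] Opaque emb.

(** Inequalities are passed on as [emb x + 1 <= emb y], which keeps the
    discreteness of the order visible to [lra]. *)
Ltac note_nonneg t :=
  let P := type of (emb_ge0 t) in
  lazymatch goal with
  | _ : P |- _ => fail
  | _ => let H := fresh in pose proof (emb_ge0 t) as H
  end.

Ltac is_literal k := lazymatch k with O => idtac | S ?j => is_literal j end.

Ltac embed :=
  repeat match goal with
  | H : mlt _ ?x ?y |- _ => apply (proj1 (emb_lt1 x y)) in H
  | H : ~ mlt _ ?x ?y |- _ => apply (proj1 (emb_nlt x y)) in H
  | H : @eq (num _) ?x ?y |- _ => apply (proj1 (emb_eq x y)) in H
  end;
  repeat match goal with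
  | _ : context [mmul _ ?x ?y] |- _ => note_nonneg (mmul _ x y)
  | |- context [mmul _ ?x ?y] => note_nonneg (mmul _ x y)
  end;
  repeat match goal with
  | H : context [emb (madd _ ?x ?y)] |- _ => rewrite (embD x y) in H
  | H : context [emb (mmul _ ?x ?y)] |- _ => rewrite (embM x y) in H
  | H : context [emb (mzero _)] |- _ => rewrite emb0 in H
  | H : context [emb (mone _)] |- _ => rewrite emb1 in H
  | H : context [emb (nm ?k)] |- _ => is_literal k; rewrite (emb_nm k) in H
  | |- context [emb (madd _ ?x ?y)] => rewrite (embD x y)
  | |- context [emb (mmul _ ?x ?y)] => rewrite (embM x y)
  | |- context [emb (mzero _)] => rewrite emb0
  | |- context [emb (mone _)] => rewrite emb1
  | |- context [emb (nm ?k)] => is_literal k; rewrite (emb_nm k)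
  end;
  repeat match goal with
  | _ : context [emb ?x] |- _ => note_nonneg x
  | |- context [emb ?x] => note_nonneg x
  end.

Ltac arith :=
  let model := match goal with model : rca_model |- _ => model end in
  lazymatch goal with
  | |- mlt _ _ _ => apply Classical_Prop.NNPP; let H := fresh in intro H; apply (emb_absurd (M := model))
  | |- ~ _ => let H := fresh in intro H; apply (emb_absurd (M := model))
  | |- @eq (num _) _ _ => apply emb_eq
  | |- _ => exfalso; apply (emb_absurd (M := model))
  end; embed; lra.
End DifferenceRing.

(** * Sigma01 predicates *)

Section SigmaClosure.
Context {M : rca_model}.
Local Notation N := (num M).
Local Notation "0" := (mzero M).
Local Notation "1" := (mone M).
Local Infix "+" := (madd M).
Local Infix "*" := (mmul M).
Local Infix "<" := (mlt M).
Local Notation env := (nat -> N).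

Lemma S1_ext (P Q : env -> Prop) : (forall e, P e <-> Q e) -> S1 P -> S1 Q.
Proof.
  intros H (R & HR & HP). exists R. split; [exact HR|]. intros e. rewrite <- H. apply HP.
Qed.

Lemma D0_shift_body (Q : N -> env -> Prop) (xi : nat -> nat) :
  D0 (fun e => Q (e 0%nat) (fun n => e (S n))) ->
  D0 (fun e => Q (e (xi 0%nat)) (fun n => e (xi (S n)))).
Proof. exact (D0_rename _ xi). Qed.

(** Both witnesses are bounded by one number [z], which leaves a single unbounded quantifier in
    front of a bounded matrix. *)
Lemma S1_ex (P : N -> env -> Prop) :
  S1 (fun e => P (e 0%nat) (fun n => e (S n))) -> S1 (fun e => exists x, P x e).
Proof.
  intros (Q & HQ & HP).
  exists (fun z e => exists x, x < z /\ exists y, y < z /\ Q y (scons x e)). split.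
  - apply D0_bex; [definable|]. apply D0_bex; [definable|].
    (* Under the two bounded quantifiers, position 0 holds [y], position 1 holds [x], and position 2
       holds the bound [z], which [Q] has to skip. *)
    set (xi := fun n => match n with O => O | S O => 1 | S n => S (S n) end%nat).
    apply D0_ext with (fun e => Q (e (xi 0%nat)) (fun n => e (xi (S n)))); [|exact (D0_shift_body Q xi HQ)].
    intros e. replace (fun n => e (xi (S n))) with (scons (e 1%nat) (fun n => e (S (S (S n)))));
      [reflexivity|].
    apply functional_extensionality; intros [|n]; reflexivity.
  - intros e. split.
    + intros [x Hx]. apply (HP (scons x e)) in Hx as [y Hy].
      exists (x + y + 1), x. split; [arith|]. exists y. split; [arith|exact Hy].
    + intros (z & x & _ & y & _ & H). exists x. apply (HP (scons x e)). now exists y.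
Qed.

Lemma S1_and (P Q : env -> Prop) : S1 P -> S1 Q -> S1 (fun e => P e /\ Q e).
Proof.
  intros (P' & HP' & HP) (Q' & HQ' & HQ).
  exists (fun z e => (exists x, x < z /\ P' x e) /\ exists x, x < z /\ Q' x e). split.
  - apply D0_and; (apply D0_bex; [definable|]).
    + exact (D0_shift_body P' (fun n => match n with O => O | S n => S (S n) end) HP').
    + exact (D0_shift_body Q' (fun n => match n with O => O | S n => S (S n) end) HQ').
  - intros e. rewrite HP, HQ. split.
    + intros [[x Hx] [y Hy]]. exists (x + y + 1). split; [exists x|exists y]; split; auto; arith.
    + intros (z & (x & _ & Hx) & y & _ & Hy). split; eauto.
Qed.

Lemma S1_or (P Q : env -> Prop) : S1 P -> S1 Q -> S1 (fun e => P e \/ Q e).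
Proof.
  intros (P' & HP' & HP) (Q' & HQ' & HQ).
  exists (fun z e => P' z e \/ Q' z e). split; [now apply D0_or|].
  intros e. rewrite HP, HQ. split; [intros [[x Hx]|[x Hx]]; eauto|].
  intros [x [Hx|Hx]]; eauto.
Qed.

Lemma S1_Exists (T : Type) (P : T -> env -> Prop) (L : list T) :
  (forall a, S1 (P a)) -> S1 (fun e => Exists (fun a => P a e) L).
Proof.
  intros H. induction L as [|a L IH].
  - apply S1_ext with (fun _ => False); [|apply D0_S1, D0_False].
    intros e. now rewrite Exists_nil.
  - apply S1_ext with (fun e => P a e \/ Exists (fun a => P a e) L); [|now apply S1_or].
    intros e. now rewrite Exists_cons.
Qed.

(** A term is substituted by naming its value with a bounded quantifier. *)
Lemma D0_unary (P : N -> Prop) f : D0 (fun e => P (e 0%nat)) -> TM f -> D0 (fun e => P (f e)).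
Proof.
  intros HP Hf. apply D0_ext with (fun e => exists x, x < f e + 1 /\ x = f e /\ P x).
  - intros e. split; [now intros (x & _ & -> & Hx)|].
    intros H. exists (f e). split; [arith|]. now split.
  - apply D0_bex; [definable|]. apply D0_and; [|exact HP].
    apply TM_D0_eq; [definable|]. destruct Hf as (t & w & Hf).
    exists t, (fun i => match w i with inl n => inl (S n) | inr c => inr c end).
    intros e. rewrite Hf. f_equal. apply functional_extensionality; intros i. unfold wire. now destruct (w i).
Qed.

Lemma D0_binary (P : N -> N -> Prop) f g :
  D0 (fun e => P (e 0%nat) (e 1%nat)) -> TM f -> TM g -> D0 (fun e => P (f e) (g e)).
Proof.
  intros HP Hf Hg.
  apply D0_ext with (fun e => exists x, x < f e + 1 /\ exists y, y < g e + 1 /\ x = f e /\ y = g e /\ P x y).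
  - intros e. split; [now intros (x & _ & y & _ & -> & -> & Hx)|].
    intros H. exists (f e). split; [arith|]. exists (g e). split; [arith|]. now split.
  - assert (Hs : forall f k, TM f -> TM (fun e : env => f (fun n => e (k + n)%nat))).
    { intros f' k (t & w & Hf').
      exists t, (fun i => match w i with inl n => inl (k + n)%nat | inr c => inr c end).
      intros e. rewrite Hf'. f_equal. apply functional_extensionality; intros i. unfold wire. now destruct (w i). }
    apply D0_bex; [definable|]. apply D0_bex; [apply TM_add; [exact (Hs g 1%nat Hg)|definable]|].
    apply D0_and; [apply TM_D0_eq; [definable|exact (Hs f 2%nat Hf)]|].
    apply D0_and; [apply TM_D0_eq; [definable|exact (Hs g 2%nat Hg)]|].
    exact (D0_rename _ (fun n => match n with O => 1 | S O => O | n => n end)%nat HP).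
Qed.
End SigmaClosure.

Ltac definable_user ::=
  match goal with
  | H : D0 (fun e => ?P (e 0%nat)) |- D0 (fun e => ?P _) => apply (D0_unary P _ H)
  | H : D0 (fun e => ?P (e 0%nat) (e 1%nat)) |- D0 (fun e => ?P _ _) => apply (D0_binary P _ _ H)
  end.

Ltac sigma_user := fail.

Ltac sigma :=
  cbv beta;
  first [ assumption
        | apply D0_S1; solve [definable]
        | lazymatch goal with
          | |- S1 (fun e => _ /\ _) => apply S1_and; sigma
          | |- S1 (fun e => _ \/ _) => apply S1_or; sigma
          | |- S1 (fun e => exists x, _) => apply S1_ex; sigma
          | |- _ => sigma_user; sigma
          end ].

(** * Number theory in a model *)

Section NumberTheory.
Context {M : rca_model}.
Local Notation N := (num M).
Local Notation "0" := (mzero M).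
Local Notation "1" := (mone M).
Local Infix "+" := (madd M).
Local Infix "*" := (mmul M).
Local Infix "<" := (mlt M).
Local Notation "x <= y" := (mlt M x (madd M y (mone M))).
Local Notation "'#' k" := (nm k%nat : N) (at level 1, format "# k").

Lemma strong_induction (P : N -> Prop) :
  D0 (fun e => P (e 0%nat)) -> (forall x, (forall y, y < x -> P y) -> P x) -> forall x, P x.
Proof.
  intros HP H x. apply H. pattern x; revert x; apply D0_induction; [definable|..].
  - intros y Hy. now apply nlt_0_r in Hy.
  - intros x IH y [Hy| ->]%lt_succ_r; auto.
Qed.

Lemma least_number (P : N -> Prop) a :
  D0 (fun e => P (e 0%nat)) -> P a -> exists m, P m /\ forall y, y < m -> ~ P y.
Proof.
  intros HP Ha. apply NNPP. intros HN.
  revert Ha. change (~ P a). pattern a; revert a; apply strong_induction; [definable|].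
  intros x IH Hx. apply HN. now exists x.
Qed.

(** If no element were greatest, Sigma01 induction on [x] would find an element of [P] that is at
    least [x], and [x = b + 1] is too far. *)
Lemma greatest_number (P : N -> Prop) a b :
  S1 (fun e => P (e 0%nat)) -> P a -> (forall x, P x -> x <= b) ->
  exists m, P m /\ forall x, P x -> x <= m.
Proof.
  intros HP Ha Hb. apply NNPP. intros HN.
  assert (H : forall x, exists v, x <= v /\ P v).
  { apply S1_induction; [sigma|..].
    - exists a. split; [arith|exact Ha].
    - intros x (v & Hv & HPv). apply NNPP. intros HN'. apply HN. exists v. split; [exact HPv|].
      intros y Hy. apply NNPP. intros Hlt. apply HN'. exists y. split; [arith|exact Hy]. }
  destruct (H (b + 1)) as (v & Hv & HPv). apply Hb in HPv. arith.
Qed.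

Lemma division n d : 0 < d -> exists q r, n = d * q + r /\ r < d.
Proof.
  intros Hd. assert (H : exists q, q <= n /\ exists r, r < d /\ n = d * q + r).
  { pattern n; revert n; apply D0_induction; [definable|..].
    - exists 0. split; [arith|]. exists 0. split; [arith|arith].
    - intros n (q & Hq & r & Hr & Hn).
      destruct (lt_trichotomy (r + 1) d) as [H|[H|H]]; [| |arith].
      + exists q. split; [arith|]. exists (r + 1). split; [arith|arith].
      + exists (q + 1). split; [arith|]. exists 0. split; arith. }
  destruct H as (q & _ & r & Hr & Hn). now exists q, r.
Qed.

Lemma division_unique d q r q' r' :
  r < d -> r' < d -> d * q + r = d * q' + r' -> q = q' /\ r = r'.
Proof.
  intros Hr Hr' H. destruct (lt_trichotomy q q') as [[z ->]%lt_exists|[ ->|[z ->]%lt_exists]].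
  (* Products are atoms for [arith]. Mentioning one in a hypothesis makes its nonnegativity
     available; the same device recurs below. *)
  - assert (Hz := nlt_0_r (d * z)). arith.
  - split; [reflexivity|arith].
  - assert (Hz := nlt_0_r (d * z)). arith.
Qed.

Lemma mul_cancel_l d x y : 0 < d -> d * x = d * y -> x = y.
Proof.
  intros Hd H. apply (division_unique d x 0 y 0 Hd Hd). arith.
Qed.

Lemma factor_le d k : 0 < d * k -> d <= d * k /\ k <= d * k.
Proof.
  intros H. destruct (succ_or_0 k) as [->|[z ->]]; [arith|].
  destruct (succ_or_0 d) as [->|[t ->]]; [arith|].
  assert (Hz := nlt_0_r (t * z)). split; arith.
Qed.

Lemma nm_add i j : #(i + j) = #i + #j.
Proof. induction i as [|i IH]; simpl; [arith|]. rewrite IH. arith. Qed.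

Lemma nm_mul i j : #(i * j) = #i * #j.
Proof. induction i as [|i IH]; simpl; [arith|]. rewrite nm_add, IH. arith. Qed.

Lemma nm_lt i j : (i < j)%nat -> #i < #j.
Proof.
  intros H. replace j with (i + (j - i - 1) + 1)%nat by lia. rewrite !nm_add. simpl. arith.
Qed.

(** The bound on the cofactor keeps divisibility bounded; by [dvd_intro] nothing is lost. *)
Definition dvd (d n : N) : Prop := exists k, k <= n /\ n = d * k.

Lemma dvd_intro d k : dvd d (d * k).
Proof.
  destruct (succ_or_0 (d * k)) as [H|[z H]].
  - exists 0. split; arith.
  - exists k. split; [|reflexivity]. apply factor_le. arith.
Qed.

Lemma dvd_add d m n : dvd d m -> dvd d n -> dvd d (m + n).
Proof.
  intros (k & _ & ->) (j & _ & ->). replace (d * k + d * j) with (d * (k + j)) by arith.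
  apply dvd_intro.
Qed.

Lemma dvd_add_cancel d m n : dvd d (m + n) -> dvd d m -> dvd d n.
Proof.
  intros (k & _ & H) (j & _ & ->).
  destruct (lt_trichotomy j k) as [[z ->]%lt_exists|[ ->|[z ->]%lt_exists]].
  - replace n with (d * (z + 1)) by arith. apply dvd_intro.
  - replace n with (d * 0) by arith. apply dvd_intro.
  - assert (Hz := nlt_0_r (d * z)). replace n with (d * 0); [apply dvd_intro|].
    destruct (succ_or_0 n) as [->|[t ->]]; arith.
Qed.

Lemma dvd_mul_r d m n : dvd d m -> dvd d (m * n).
Proof.
  intros (k & _ & ->). replace (d * k * n) with (d * (k * n)) by arith. apply dvd_intro.
Qed.

Lemma dvd_trans d m n : dvd d m -> dvd m n -> dvd d n.
Proof. intros H (k & _ & ->). now apply dvd_mul_r. Qed.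

Lemma dvd_le d n : dvd d n -> 0 < n -> d <= n.
Proof. intros (k & _ & ->) H. now apply factor_le. Qed.

(** * Powers of seven *)

(** The digit is a number of the metatheory, found by induction outside the model, so that facts
    about digits reduce to finite checks. *)
Lemma mod7 n : exists a i, (i < 7)%nat /\ n = #7 * a + #i.
Proof.
  destruct (division n #7) as (q & r & -> & Hr); [arith|].
  exists q. assert (H : forall k : nat, r < #k -> exists i, (i < k)%nat /\ r = #i).
  { induction k as [|k IH]; simpl; [intros H; now apply nlt_0_r in H|].
    intros [H| ->]%lt_succ_r; [|exists k; split; [lia|reflexivity]].
    destruct (IH H) as (i & Hi & ->). exists i. split; [lia|reflexivity]. }
  destruct (H 7%nat Hr) as (i & Hi & ->). now exists i.
Qed.

Lemma mod7_unique a i b j : (i < 7)%nat -> (j < 7)%nat ->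
  #7 * a + #i = #7 * b + #j -> a = b /\ i = j.
Proof.
  intros Hi Hj H. destruct (division_unique _ _ _ _ _ (nm_lt _ _ Hi) (nm_lt _ _ Hj) H) as [-> H'].
  split; [reflexivity|]. destruct (Nat.lt_trichotomy i j) as [Hlt|[->|Hlt]]; [|reflexivity|];
    apply nm_lt in Hlt; arith.
Qed.

Lemma not_dvd7 a i : (0 < i < 7)%nat -> ~ dvd #7 (#7 * a + #i).
Proof.
  intros Hi (k & _ & H).
  destruct (mod7_unique a i k 0) as [_ Hi']; [lia|lia|simpl; arith|lia].
Qed.

Lemma not_dvd7_digit n : ~ dvd #7 n -> exists a i, (0 < i < 7)%nat /\ n = #7 * a + #i.
Proof.
  intros H. destruct (mod7 n) as (a & [|i] & Hi & ->).
  - exfalso. apply H. replace (#7 * a + #0) with (#7 * a) by arith. apply dvd_intro.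
  - exists a, (S i). split; [lia|reflexivity].
Qed.

Lemma mul_mod7_nonzero i j : (0 < i < 7)%nat -> (0 < j < 7)%nat ->
  (0 < (i * j) mod 7 < 7)%nat.
Proof.
  intros Hi Hj. split; [|apply Nat.mod_upper_bound; lia].
  do 7 (destruct i as [|i]; [do 7 (destruct j as [|j]; [simpl; lia|]); lia|]). lia.
Qed.

Lemma euclid7 a b : dvd #7 (a * b) -> dvd #7 a \/ dvd #7 b.
Proof.
  intros H. apply NNPP. intros [Ha Hb]%not_or_and.
  apply not_dvd7_digit in Ha as (a' & i & Hi & ->), Hb as (b' & j & Hj & ->).
  revert H. replace ((#7 * a' + #i) * (#7 * b' + #j)) with
    (#7 * (#7 * a' * b' + a' * #j + #i * b' + #(i * j / 7)) + #((i * j) mod 7)).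
  - apply not_dvd7, mul_mod7_nonzero; assumption.
  - assert (HE := nm_mul i j). rewrite (Nat.div_mod_eq (i * j) 7), nm_add, nm_mul in HE. arith.
Qed.

(** The powers of 7, exponentiation not being available as a term. *)
Definition Pow (q : N) : Prop :=
  0 < q /\ forall d, d <= q -> forall k, k <= q -> q = d * k -> d = 1 \/ dvd #7 d.

Lemma Pow_pos q : Pow q -> 0 < q.
Proof. now intros []. Qed.

Lemma Pow_divisor q d k : Pow q -> q = d * k -> d = 1 \/ dvd #7 d.
Proof.
  intros [Hq H] E. assert (Hf := factor_le d k). rewrite <- E in Hf.
  destruct (Hf Hq) as [H1 H2]. now apply (H d H1 k H2).
Qed.

Lemma Pow_1 : Pow 1.
Proof.
  split; [arith|]. intros d _ k _ E. left.
  destruct (succ_or_0 d) as [->|[t ->]]; [arith|].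
  destruct (succ_or_0 k) as [->|[z ->]]; [arith|].
  destruct (succ_or_0 t) as [->|[u ->]]; [arith|].
  assert (H1 := nlt_0_r (u * z)). arith.
Qed.

Lemma Pow_mul7 q : Pow q -> Pow (#7 * q).
Proof.
  intros Hq. split; [assert (H := Pow_pos _ Hq); arith|].
  intros d _ k _ E.
  destruct (euclid7 d k) as [H|(k' & _ & ->)]; [rewrite <- E; apply dvd_intro|now right|].
  apply (Pow_divisor q d k' Hq). apply (mul_cancel_l #7); [arith|]. rewrite E. arith.
Qed.

Lemma Pow_div7 q : Pow q -> q <> 1 -> exists p, q = #7 * p /\ Pow p.
Proof.
  intros Hq Hq1. destruct (Pow_divisor q q 1 Hq) as [H|(p & _ & E)]; [arith|contradiction|].
  exists p. split; [exact E|]. split.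
  - assert (H := Pow_pos _ Hq). arith.
  - intros d _ k _ E'. apply (Pow_divisor q d (#7 * k) Hq). rewrite E, E'. arith.
Qed.

Lemma D0_dvd (f g : (nat -> N) -> N) : TM f -> TM g -> D0 (fun e => dvd (f e) (g e)).
Proof. apply (D0_binary dvd). unfold dvd. definable. Qed.

Lemma D0_Pow (f : (nat -> N) -> N) : TM f -> D0 (fun e => Pow (f e)).
Proof.
  apply (D0_unary Pow). unfold Pow.
  apply D0_and; [definable|]. apply D0_ball; [definable|]. apply D0_ball; [definable|].
  apply D0_imp; [definable|]. apply D0_or; [definable|]. apply D0_dvd; definable.
Qed.
End NumberTheory.

Ltac definable_user ::=
  match goal with
  | |- D0 (fun e => dvd _ _) => apply D0_dvd
  | |- D0 (fun e => Pow _) => apply D0_Pow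
  | H : D0 (fun e => ?P (e 0%nat)) |- D0 (fun e => ?P _) => apply (D0_unary P _ H)
  | H : D0 (fun e => ?P (e 0%nat) (e 1%nat)) |- D0 (fun e => ?P _ _) => apply (D0_binary P _ _ H)
  end.

(** * The largest power of 7 dividing a number, and the parity of the splits *)

Section Splits.
Context {M : rca_model}.
Local Notation N := (num M).
Local Notation "0" := (mzero M).
Local Notation "1" := (mone M).
Local Infix "+" := (madd M).
Local Infix "*" := (mmul M).
Local Infix "<" := (mlt M).
Local Notation "x <= y" := (mlt M x (madd M y (mone M))).
Local Notation "'#' k" := (nm k%nat : N) (at level 1, format "# k").

Lemma Pow_dvd p q : Pow p -> Pow q -> p <= q -> dvd p q.
Proof.
  (* The induction hypothesis must cover all [q] at once, and a bounded formula can do so only for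
     [q] below a fixed [B]. *)
  intros Hp Hq Hpq. assert (HB : exists B, q <= B) by (exists q; arith).
  destruct HB as [B HB]. revert q HB Hp Hq Hpq.
  enough (H : forall q, q < B + 1 -> Pow p -> Pow q -> p <= q -> dvd p q) by exact H.
  pattern p; revert p; apply strong_induction; [definable|].
  intros p IH q HB Hp Hq Hpq.
  destruct (classic (p = 1)) as [->|Hp1].
  { replace q with (1 * q) by arith. apply dvd_intro. }
  assert (Hq1 : q <> 1).
  { intros ->. apply Hp1. assert (H := Pow_pos _ Hp). 
    destruct (succ_or_0 p) as [->|[t ->]]; [arith|]. destruct (succ_or_0 t) as [->|[u ->]]; arith. }
  apply Pow_div7 in Hp as (p' & -> & Hp); [|exact Hp1].
  apply Pow_div7 in Hq as (q' & -> & Hq); [|exact Hq1].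
  assert (H := Pow_pos _ Hp).
  destruct (IH p') with (q := q') as (k & _ & ->); [arith|arith|assumption..|arith|].
  replace (#7 * (p' * k)) with (#7 * p' * k) by arith. apply dvd_intro.
Qed.

Lemma Pow_lt_factor p q : Pow p -> Pow q -> p < q -> exists k, q = #7 * p * k.
Proof.
  intros Hp Hq Hpq. destruct (Pow_dvd p q) as (k & _ & ->); [assumption..|arith|].
  destruct (Pow_divisor (p * k) k p Hq) as [->|(j & _ & ->)]; [arith|arith|].
  exists j. arith.
Qed.

Lemma Pow_lt_mul7 p q : Pow p -> Pow q -> p < q -> #7 * p <= q.
Proof.
  intros Hp Hq Hpq. destruct (Pow_lt_factor p q) as [k ->]; [assumption..|].
  apply (factor_le (#7 * p) k). now apply Pow_pos.
Qed.

Lemma Pow_unbounded x : exists q, Pow q /\ x < q.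
Proof.
  pattern x; revert x; apply S1_induction; [sigma|..].
  - exists 1. split; [apply Pow_1|arith].
  - intros x (q & Hq & H). exists (#7 * q). split; [now apply Pow_mul7|arith].
Qed.

(** An even power of 7 would have the divisor 2. Oddness is what makes one additional digit 1 change
    the parity of a code. *)
Lemma Pow_odd q k : Pow q -> q <> #2 * k.
Proof.
  intros Hq E. destruct (Pow_divisor q #2 k Hq E) as [H|(j & _ & H)]; [arith|].
  destruct (succ_or_0 j) as [->|[t ->]]; arith.
Qed.

(** The largest power of 7 dividing [n], as the graph of a function undefined at 0. The power stands
    in for its exponent. *)
Definition lam (n l : N) : Prop :=
  Pow l /\ exists v, v <= n /\ n = l * v /\ ~ dvd #7 v.

Lemma lam_intro l v : Pow l -> ~ dvd #7 v -> lam (l * v) l.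
Proof.
  intros Hl Hv. split; [exact Hl|]. exists v. split; [|now split].
  destruct (succ_or_0 v) as [->|[t ->]]; [arith|].
  apply factor_le. assert (H := Pow_pos _ Hl). assert (H1 := nlt_0_r (l * t)). arith.
Qed.

Lemma lam_exists n : 0 < n -> exists l, lam n l.
Proof.
  intros Hn. enough (H : 0 < n -> exists l, l <= n /\ lam n l) by (destruct (H Hn) as (l & _ & H'); eauto).
  clear Hn. pattern n; revert n; apply strong_induction; [unfold lam; definable|].
  intros n IH Hn. destruct (classic (dvd #7 n)) as [(m & _ & ->)|Hd].
  - destruct (IH m) as (l & Hl & Hl' & v & Hv & -> & Hd); [arith|arith|].
    exists (#7 * l). split; [arith|]. replace (#7 * (l * v)) with (#7 * l * v) by arith.
    apply lam_intro; [now apply Pow_mul7|exact Hd].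
  - exists 1. split; [arith|]. replace n with (1 * n) by arith. apply lam_intro; [apply Pow_1|exact Hd].
Qed.

Lemma lam_unique_le n l l' : lam n l -> lam n l' -> ~ l < l'.
Proof.
  intros (Hl & v & _ & E & Hv) (Hl' & v' & _ & E' & Hv') H.
  destruct (Pow_lt_factor l l') as [k ->]; [assumption..|].
  apply Hv. replace v with (#7 * (k * v')); [apply dvd_intro|].
  apply (mul_cancel_l l); [now apply Pow_pos|]. rewrite <- E, E'. arith.
Qed.

Lemma lam_unique n l l' : lam n l -> lam n l' -> l = l'.
Proof.
  intros H H'. destruct (lt_trichotomy l l') as [Hlt|[Heq|Hlt]]; [|exact Heq|];
    exfalso; revert Hlt; eapply lam_unique_le; eassumption.
Qed.

Lemma lam_ge_dvd n l q : lam n l -> 0 < n -> Pow q -> dvd q n -> q <= l.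
Proof.
  intros (Hl & v & _ & -> & Hv) Hn Hq (k & _ & E). apply NNPP. intros Hlt.
  destruct (Pow_lt_factor l q) as [j ->]; [assumption..|arith|].
  apply Hv. replace v with (#7 * (j * k)); [apply dvd_intro|].
  apply (mul_cancel_l l); [now apply Pow_pos|]. rewrite E. arith.
Qed.

(** Think of [theta x y] as: [x] is enumerated at stage [y]. A split of [n] is a
    power [q] of 7 with nonzero digit in [n] such that, for [u] the part of [n]
    below [q], some number below [l] is first enumerated at a stage [y] with
    [u <= y < q].
    Splits are coded by the number with digit 1 at the splits and 0 elsewhere. *)
Context (theta : N -> N -> Prop) (Htheta : D0 (fun e => theta (e 0%nat) (e 1%nat))).

Definition new_below (l u q : N) : Prop :=
  exists x, x < l /\ (exists y, y < q /\ theta x y) /\ ~ exists y, y < u /\ theta x y.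

Definition split (n l q : N) : Prop :=
  exists k, k <= n /\ exists u, u < q /\ n = q * k + u /\ ~ dvd #7 k /\ new_below l u q.

Definition digit (w q d : N) : Prop :=
  exists k, k <= w /\ exists u, u < q /\ w = q * (#7 * k + d) + u.

Definition splits_code (n l Q w : N) : Prop :=
  w < Q /\ forall q, q < Q -> Pow q ->
    (split n l q /\ digit w q 1) \/ (~ split n l q /\ digit w q 0).

Lemma splits_code_D0 : D0 (fun e => splits_code (e 0%nat) (e 1%nat) (e 2%nat) (e 3%nat)).
Proof. unfold splits_code, split, digit, new_below. definable. Qed.

Lemma split_intro n l q k u :
  n = q * k + u -> u < q -> ~ dvd #7 k -> new_below l u q -> split n l q.
Proof.
  intros E Hu Hk H. exists k. split; [|exists u; tauto].
  destruct (succ_or_0 q) as [->|[t ->]]; [arith|]. assert (H1 := nlt_0_r (t * k)). arith.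
Qed.

Lemma digit_intro w q d k u : w = q * (#7 * k + d) + u -> u < q -> digit w q d.
Proof.
  intros E Hu. exists k. split; [|now exists u].
  destruct (succ_or_0 q) as [->|[t ->]]; [arith|].
  assert (H1 := nlt_0_r (t * (#7 * k + d))). assert (H2 := nlt_0_r d). arith.
Qed.

Lemma digit_add w q d k : digit w q d -> digit (w + #7 * q * k) q d.
Proof.
  intros (j & _ & u & Hu & ->). apply (digit_intro _ _ _ (j + k) u); [arith|exact Hu].
Qed.

(** The code below [7 P] is the code below [P], plus [P] in case [P] is a split. The bound [w < Q]
    makes the claim a bounded formula, fit for [strong_induction]. *)
Lemma splits_code_exists n l Q : Pow Q -> exists w, splits_code n l Q w.
Proof.
  assert (HD := splits_code_D0).
  enough (H : Pow Q -> exists w, w < Q /\ splits_code n l Q w).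
  { intros HQ. destruct (H HQ) as (w & _ & Hw). now exists w. }
  pattern Q; revert Q; apply strong_induction.
  { unfold splits_code, split, digit, new_below. definable. }
  intros Q IH HQ. destruct (classic (Q = 1)) as [->|HQ1].
  - exists 0. split; [arith|]. split; [arith|]. intros q Hq Hp. assert (H := Pow_pos _ Hp). arith.
  - apply Pow_div7 in HQ as (P & -> & HP); [|exact HQ1].
    assert (HP0 := Pow_pos _ HP).
    destruct (IH P) as (w & _ & Hw & Hdig); [arith|exact HP|].
    assert (H : forall d : nat, (d < 2)%nat ->
      (split n l P /\ #d = 1 \/ ~ split n l P /\ #d = 0) ->
      exists w, w < #7 * P /\ splits_code n l (#7 * P) w).
    { intros d Hd HS. assert (Hlt : w + P * #d < #7 * P).
      { destruct d as [|[|d]]; [arith|arith|lia]. }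
      exists (w + P * #d). split; [exact Hlt|]. split; [exact Hlt|].
      intros q Hq Hpq. destruct (lt_trichotomy q P) as [HqP|[->|HqP]].
      - destruct (Pow_lt_factor q P) as [k ->]; [assumption..|].
        replace (w + #7 * q * k * #d) with (w + #7 * q * (k * #d)) by arith.
        destruct (Hdig q HqP Hpq) as [[H1 H2]|[H1 H2]]; [left|right]; (split; [exact H1|now apply digit_add]).
      - destruct HS as [[H1 H2]|[H1 H2]]; [left|right]; (split; [exact H1|]); rewrite H2;
          (apply (digit_intro _ _ _ 0 w); [arith|exact Hw]).
      - apply Pow_lt_mul7 in HqP; [arith|assumption..]. }
    destruct (classic (split n l P)) as [HS|HS].
    + apply (H 1%nat); [lia|]. left. split; [exact HS|]. simpl. arith.
    + apply (H 0%nat); [lia|]. right. split; [exact HS|]. reflexivity.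
Qed.

(** By induction on the power [p], both codes leave the same remainder modulo [p]; at [p = Q] the
    remainders are the codes themselves. *)
Lemma splits_code_unique n l Q w w' : Pow Q ->
  splits_code n l Q w -> splits_code n l Q w' -> w = w'.
Proof.
  intros HQ [Hw Hd] [Hw' Hd'].
  assert (H : forall p, Pow p -> p < Q + 1 -> exists u, u < p /\
    (exists k, k <= w /\ w = p * k + u) /\ exists k, k <= w' /\ w' = p * k + u).
  { apply (strong_induction (fun p => Pow p -> p < Q + 1 -> exists u, u < p /\
      (exists k, k <= w /\ w = p * k + u) /\ exists k, k <= w' /\ w' = p * k + u)); [definable|].
    intros p IH Hp HpQ. destruct (classic (p = 1)) as [->|Hp1].
    { exists 0. split; [arith|]. split; [exists w|exists w']; (split; arith). }
    apply Pow_div7 in Hp as (q & -> & Hq); [|exact Hp1].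
    assert (Hq0 := Pow_pos _ Hq).
    destruct (IH q) as (u & Hu & (k & Hk & E) & (k' & Hk' & E')); [arith|exact Hq|arith|].
    assert (Hdig : exists d : nat, (d < 2)%nat /\ digit w q #d /\ digit w' q #d).
    { destruct (Hd q) as [[H1 H2]|[H1 H2]]; [arith|exact Hq| |];
      (destruct (Hd' q) as [[H3 H4]|[H3 H4]]; [arith|exact Hq| |]); try contradiction.
      - exists 1%nat. replace (#1) with 1 by (simpl; arith). auto.
      - exists 0%nat. auto. }
    destruct Hdig as (d & Hd2 & (j & _ & v & Hv & F) & (j' & _ & v' & Hv' & F')).
    assert (D := division_unique _ _ _ _ _ Hu Hv (eq_trans (eq_sym E) F)).
    assert (D' := division_unique _ _ _ _ _ Hu Hv' (eq_trans (eq_sym E') F')).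
    destruct D as [_ <-], D' as [_ <-].
    assert (Hj : forall j w, w = q * (#7 * j + #d) + u -> j <= w).
    { clear -Hq0. intros j w ->. destruct (succ_or_0 q) as [->|[t ->]]; [arith|].
      assert (H1 := nlt_0_r (t * (#7 * j + #d))). arith. }
    exists (q * #d + u). split; [destruct d as [|[|d]]; [arith|arith|lia]|].
    split; [exists j|exists j']; (split; [now apply Hj|]); [rewrite F|rewrite F']; arith. }
  destruct (H Q HQ) as (u & Hu & (k & _ & E) & k' & _ & E'); [arith|].
  assert (Hz : forall w k, w < Q -> w = Q * k + u -> w = u).
  { clear. intros w k Hw ->. destruct (succ_or_0 k) as [->|[t ->]]; [arith|].
    assert (H1 := nlt_0_r (Q * t)). arith. }
  rewrite (Hz w k Hw E), (Hz w' k' Hw' E'). reflexivity.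
Qed.

Lemma split_lt n l q : n < q -> ~ split n l q.
Proof.
  intros Hq (k & _ & u & Hu & E & Hk & _). apply Hk.
  destruct (succ_or_0 k) as [->|[t ->]]; [|assert (H1 := nlt_0_r (q * t)); arith].
  replace 0 with (#7 * 0) by arith. apply dvd_intro.
Qed.

(** At a power above [n] the quotient is 0, which 7 divides, so no split occurs there and the code
    only gains digits 0. *)
Lemma splits_code_extend n l Q Q' w : n < Q -> Q <= Q' ->
  splits_code n l Q w -> splits_code n l Q' w.
Proof.
  intros HnQ HQ' [Hw Hd]. split; [arith|]. intros q Hq Hp.
  destruct (classic (q < Q)) as [HqQ|HqQ]; [auto|]. right. split.
  - apply split_lt. arith.
  - apply (digit_intro _ _ _ 0 w); arith.
Qed.

(** Powers of 7 are odd, so the parity of the code is that of the number of splits. The choice of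
    [Q] above [n] is immaterial; therefore each parity is a Sigma01 condition and the negation of
    the other. *)
Definition split_parity (n l i : N) : Prop :=
  exists Q w, Pow Q /\ n < Q /\ splits_code n l Q w /\ exists k, k <= w /\ w = #2 * k + i.

Lemma split_parity_at n l i Q : split_parity n l i -> Pow Q -> n < Q ->
  exists w, splits_code n l Q w /\ exists k, w = #2 * k + i.
Proof.
  intros (P & w & HP & HnP & Hw & k & _ & E) HQ HnQ.
  destruct (splits_code_exists n l Q HQ) as [w' Hw']. exists w'. split; [exact Hw'|].
  exists k. rewrite <- E.
  destruct (lt_trichotomy P Q) as [H|[->|H]].
  - apply (splits_code_unique n l Q); [assumption..|]. apply splits_code_extend with P; [assumption|arith|assumption].
  - now apply (splits_code_unique n l Q).
  - apply (splits_code_unique n l P); [assumption| |assumption].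
    apply splits_code_extend with Q; [assumption|arith|assumption].
Qed.

Lemma parity_exclusive j k : #2 * j + 0 <> #2 * k + 1.
Proof.
  intros E. destruct (division_unique #2 j 0 k 1) as [_ H]; [arith|arith|exact E|arith].
Qed.

Lemma split_parity_unique n l : split_parity n l 0 -> ~ split_parity n l 1.
Proof.
  intros H0 H1. destruct (Pow_unbounded n) as (Q & HQ & HnQ).
  destruct (split_parity_at _ _ _ Q H0 HQ HnQ) as (w & Hw & k & Hk).
  destruct (split_parity_at _ _ _ Q H1 HQ HnQ) as (w' & Hw' & k' & Hk').
  rewrite (splits_code_unique n l Q w w' HQ Hw Hw'), Hk' in Hk. symmetry in Hk. now apply parity_exclusive in Hk.
Qed.

Lemma parity_cases n : exists k, k <= n /\ (n = #2 * k + 0 \/ n = #2 * k + 1).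
Proof.
  destruct (division n #2) as (q & r & -> & Hr); [arith|]. exists q. split; [arith|].
  destruct (succ_or_0 r) as [->|[t ->]]; [now left|].
  destruct (succ_or_0 t) as [->|[u ->]]; [right; arith|arith].
Qed.

Lemma split_parity_exists n l : split_parity n l 0 \/ split_parity n l 1.
Proof.
  destruct (Pow_unbounded n) as (Q & HQ & HnQ), (splits_code_exists n l Q HQ) as [w Hw].
  destruct (parity_cases w) as (k & Hk & [E|E]); [left|right];
    (exists Q, w; repeat (split; [assumption|]); now exists k).
Qed.

(** Appending a number [m] past the stage [b] at which the numbers below [l]
    have all been enumerated creates exactly one new split, and powers of 7 are odd. *)
Lemma split_parity_flip n m l b q i : lam m q -> n < q -> b <= q ->
  (forall x, x < l -> (exists y, theta x y) -> exists y, y < b /\ theta x y) ->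
  (exists x, x < l /\ (exists y, theta x y) /\ ~ exists y, y < n /\ theta x y) ->
  split_parity n l i -> ~ split_parity (n + m) l i.
Proof.
  intros (Hq & v & _ & Em & Hv) Hnq Hbq Hb (x & Hx & Hex & Hnx) Hi Hj.
  destruct (Pow_unbounded (n + m)) as (Q & HQ & HnQ).
  destruct (split_parity_at _ _ _ q Hi Hq Hnq) as (w & [Hw Hd] & k & Hk).
  destruct (split_parity_at _ _ _ Q Hj HQ HnQ) as (w' & Hw' & k' & Hk').
  assert (Hq0 := Pow_pos _ Hq).
  assert (HqQ : q < Q).
  { destruct (succ_or_0 v) as [->|[t ->]].
    - exfalso. apply Hv. replace 0 with (#7 * 0) by arith. apply dvd_intro.
    - assert (H1 := nlt_0_r (q * t)). arith. }
  assert (Hcode : splits_code (n + m) l Q (w + q)).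
  { split. { apply Pow_lt_mul7 in HqQ; [arith|assumption..]. }
    intros p Hp Hpp. assert (Hp0 := Pow_pos _ Hpp).
    destruct (lt_trichotomy p q) as [Hpq|[->|Hpq]].
    (* Below [q]: [m] is a multiple of [7 p], so [n + m] agrees with [n] in the digit at [p] and in
       the part below [p]. *)
    - destruct (Pow_lt_factor p q) as [c Ec]; [assumption..|].
      assert (HS : split (n + m) l p <-> split n l p).
      { split; intros (k1 & _ & u & Hu & E & Hk1 & HN).
        - destruct (division n p Hp0) as (k2 & u2 & E2 & Hu2).
          destruct (division_unique p (k2 + #7 * (c * v)) u2 k1 u Hu2 Hu) as [Ek <-].
          { rewrite <- E, E2, Em, Ec. arith. }
          apply (split_intro _ _ _ k2 u2); [exact E2|exact Hu2| |exact HN].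
          intros H. apply Hk1. rewrite <- Ek. apply dvd_add; [exact H|apply dvd_intro].
        - apply (split_intro _ _ _ (k1 + #7 * (c * v)) u); [|exact Hu| |exact HN].
          + rewrite E, Em, Ec. arith.
          + intros H. apply Hk1. apply (dvd_add_cancel _ (#7 * (c * v))); [|apply dvd_intro].
            replace (#7 * (c * v) + k1) with (k1 + #7 * (c * v)) by arith. exact H. }
      rewrite HS. replace (w + q) with (w + #7 * p * c) by (rewrite Ec; arith).
      destruct (Hd p Hpq Hpp) as [[H1 H2]|[H1 H2]]; [left|right]; (split; [exact H1|now apply digit_add]).
    (* At [q]: the part of [n + m] below [q] is [n], and [x] is enumerated before [b], hence before
       [q], but not before [n]. *)
    - left. split; [|apply (digit_intro _ _ _ 0 w); [arith|exact Hw]].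
      apply (split_intro _ _ _ v n); [rewrite Em; arith|exact Hnq|exact Hv|].
      exists x. split; [exact Hx|]. split; [|exact Hnx].
      destruct (Hb x Hx Hex) as (y & Hy & Hxy). exists y. split; [arith|exact Hxy].
    (* Above [q]: the part [u] below [p] is at least [q], because [n + m] has a nonzero digit at
       [q]. Thus [u] is not below [b], and no number below [l] is new. *)
    - right. split.
      + intros (k1 & _ & u & Hu & E & Hk1 & x' & Hx' & (y & Hy & Hxy) & HN).
        destruct (Pow_lt_factor q p) as [c Ec]; [assumption..|].
        destruct (classic (u < q)) as [Huq|Huq].
        * destruct (division_unique q v n (#7 * (c * k1)) u Hnq Huq) as [Ev _].
          { transitivity (n + m); [rewrite Em; arith|rewrite E, Ec; arith]. }
          apply Hv. rewrite Ev. apply dvd_intro.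
        * apply HN. destruct (Hb x' Hx') as (z & Hz & Hxz); [now exists y|].
          exists z. split; [arith|exact Hxz].
      + apply (digit_intro _ _ _ 0 (w + q)); [arith|]. apply Pow_lt_mul7 in Hpq; [arith|assumption..]. }
  assert (E := splits_code_unique _ _ _ _ _ HQ Hw' Hcode).
  (* The codes [w] and [w + q] would have the same parity, although [q] is odd. *)
  destruct (parity_cases q) as (c & _ & [Ec|Ec]).
  - apply (Pow_odd q c Hq). rewrite Ec. arith.
  - apply (parity_exclusive k' (k + c)).
    assert (E' := eq_trans (eq_sym Hk') E). rewrite Hk, Ec in E'. clear - E'. arith.
Qed.
End Splits.

(** * Strong collection *)

Section StrongCollection.
Context {M : rca_model}.
Local Notation N := (num M).
Local Notation "0" := (mzero M).
Local Notation "1" := (mone M).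
Local Infix "+" := (madd M).
Local Infix "*" := (mmul M).
Local Infix "<" := (mlt M).
Local Notation "x <= y" := (mlt M x (madd M y (mone M))).
Local Notation "'#' k" := (nm k%nat : N) (at level 1, format "# k").

(** The terms of the progression are multiplied one after another by Sigma01 induction; this stands
    in for factorials. *)
Lemma common_multiple c d Q : 0 < c ->
  exists V, 0 < V /\ forall x, x < Q -> dvd (c + d * x) V.
Proof.
  intros Hc. pattern Q; revert Q; apply S1_induction; [sigma|..].
  - exists 1. split; [arith|]. intros x Hx. now apply nlt_0_r in Hx.
  - intros Q (V & HV & H). exists ((c + d * Q) * V). split.
    + apply mul_pos; [|exact HV]. assert (H1 := nlt_0_r (d * Q)). arith.
    + intros x [Hx| ->]%lt_succ_r; [|apply dvd_intro].
      rewrite (mul_comm _ V). apply dvd_mul_r, H, Hx.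
Qed.

(** [p] is the least divisor above 1. The least positive [x] such that [p] divides [x * b] divides
    every number with this property, among them [p] and [a]. Hence [x] is 1 or [p], and [p] divides
    [b] or [a] accordingly. *)
Lemma prime_divisor n : 1 < n -> exists p, 1 < p /\ dvd p n /\
  forall a b, dvd p (a * b) -> dvd p a \/ dvd p b.
Proof.
  intros Hn. destruct (least_number (fun d => 1 < d /\ dvd d n) n) as (p & [Hp Hpn] & Hmin).
  { definable. }
  { split; [exact Hn|]. replace n with (n * 1) at 2 by arith. apply dvd_intro. }
  exists p. split; [exact Hp|]. split; [exact Hpn|]. intros a b Hab.
  assert (Hirr : forall d, dvd d p -> d = 1 \/ d = p).
  { intros d Hd. assert (Hle := dvd_le d p Hd). 
    destruct (lt_trichotomy d 1) as [H|[H|H]]; [|now left|].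
    - destruct Hd as (k & _ & E). destruct (succ_or_0 d) as [->|[t ->]]; arith.
    - right. destruct (lt_trichotomy d p) as [H'|[H'|H']]; [|exact H'|].
      + exfalso. apply (Hmin d H'). split; [exact H|]. now apply dvd_trans with p.
      + assert (d <= p) by (apply Hle; arith). arith. }
  destruct (least_number (fun x => 0 < x /\ dvd p (x * b)) p) as (x & [Hx Hxb] & Hminx).
  { definable. }
  { split; [arith|apply dvd_intro]. }
  assert (Hdiv : forall c, dvd p (c * b) -> dvd x c).
  { intros c Hc. destruct (division c x Hx) as (q & r & -> & Hr).
    destruct (succ_or_0 r) as [->|[t ->]].
    - replace (x * q + 0) with (x * q) by arith. apply dvd_intro.
    - exfalso. apply (Hminx _ Hr). split; [arith|].
      apply (dvd_add_cancel p (x * b * q)); [|now apply dvd_mul_r].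
      replace (x * b * q + (t + 1) * b) with ((x * q + (t + 1)) * b) by arith. exact Hc. }
  destruct (Hirr x) as [->| ->].
  - apply Hdiv. apply dvd_intro.
  - right. replace b with (1 * b) by arith. exact Hxb.
  - left. now apply Hdiv.
Qed.

(** The least common multiple of a subfamily of the pairwise coprime numbers
    [1 + u + u * x], [x < Q], grows with the subfamily, so it serves as a bounded
    measure of how many [x < Q] have been enumerated. *)
Lemma strong_collection (theta : N -> N -> Prop) Q :
  D0 (fun e => theta (e 0%nat) (e 1%nat)) ->
  exists b, forall x, x < Q -> (exists y, theta x y) -> exists y, y < b /\ theta x y.
Proof.
  intros Htheta.
  (* As for Goedel's beta function, [u] is a multiple of all of [1, ..., Q]: a common prime factor
     of two moduli [1 + u + u * x] would divide [u], hence 1. *)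
  destruct (common_multiple 1 1 Q) as (u & Hu & Hdu); [arith|].
  destruct (common_multiple (1 + u) u Q) as (V & HV & HdV); [arith|].
  (* Here [b] is a stage, and [v] is divisible by the moduli of all [x] enumerated before it. The
     values satisfying [lcm] are the least such [v], none of them above [V]. *)
  set (multiple b v := 0 < v /\ forall x, x < Q -> (exists y, y < b /\ theta x y) -> dvd (1 + u + u * x) v).
  set (lcm v := exists b, multiple b v /\ forall v', v' < v -> ~ multiple b v').
  assert (Hlcm : forall b, exists v, multiple b v /\ forall v', v' < v -> ~ multiple b v').
  { intros b. apply (least_number (multiple b) V); [unfold multiple; definable|].
    split; [exact HV|]. auto. }
  destruct (Hlcm 0) as [v0 Hv0].
  (* At the stage of the largest value [v] the enumeration is complete: a later [x] would leave [v]
     unchanged, so its modulus would divide [v], and a prime factor [p] of this modulus could be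
     cancelled from [v]. *)
  destruct (greatest_number lcm v0 V) as (v & (b & [Hv Hdv] & Hmin) & Hmax).
  { unfold lcm, multiple. sigma. }
  { now exists 0. }
  { intros x (b & _ & Hb). apply NNPP. intros Hx. apply (Hb V); [arith|]. split; auto. }
  exists b. intros x Hx [y Hy]. apply NNPP. intros Hxb.
  destruct (Hlcm (b + y + 1)) as (v' & [Hv' Hdv'] & Hmin').
  assert (Hvv' : v' = v).
  { destruct (lt_trichotomy v' v) as [H|[H|H]]; [|exact H|].
    - exfalso. apply (Hmin v' H). split; [exact Hv'|].
      intros z Hz (t & Ht & Htheta'). apply Hdv'; [exact Hz|]. exists t. split; [arith|exact Htheta'].
    - assert (H' : v' <= v); [|arith]. apply Hmax. exists (b + y + 1). split; [now split|exact Hmin']. }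
  subst v'.
  assert (Hxv : dvd (1 + u + u * x) v).
  { apply Hdv'; [exact Hx|]. exists y. split; [arith|exact Hy]. }
  destruct (prime_divisor (1 + u + u * x)) as (p & Hp & Hpx & Hprime).
  { assert (H1 := nlt_0_r (u * x)). arith. }
  assert (Hcop : forall s t, s < t -> t < Q -> dvd p (1 + u + u * s) -> dvd p (1 + u + u * t) -> False).
  { intros s t [z ->]%lt_exists Ht H1 H2.
    assert (Hpu : dvd p u).
    (* [1 + 1 * z] is the difference of the two indices, in the shape that [Hdu] expects. *)
    { destruct (Hprime u (1 + 1 * z)) as [H|H]; [|exact H|].
      - apply (dvd_add_cancel p (1 + u + u * s)); [|exact H1].
        replace (1 + u + u * s + u * (1 + 1 * z)) with (1 + u + u * (s + z + 1)) by arith. exact H2.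
      - apply dvd_trans with (1 := H). apply Hdu. arith. }
    assert (H3 : dvd p 1).
    { apply (dvd_add_cancel p (u * (1 + s))); [|now apply dvd_mul_r].
      replace (u * (1 + s) + 1) with (1 + u + u * s) by arith. exact H1. }
    apply dvd_le in H3; arith. }
  destruct (dvd_trans _ _ _ Hpx Hxv) as (t & _ & Et).
  (* The smaller [t] is still divisible by every modulus enumerated before [b], since [p] divides
     none of these. *)
  apply (Hmin t).
  { destruct (succ_or_0 t) as [->|[t' ->]]; [arith|].
    destruct (succ_or_0 p) as [->|[p' ->]]; [arith|].
    destruct (succ_or_0 p') as [->|[p'' ->]]; [arith|].
    assert (H1 := nlt_0_r (p'' * t')). arith. }
  split.
  { destruct (succ_or_0 t) as [->|[t' ->]]; arith. }
  intros s Hs Hsb. destruct (Hdv s Hs Hsb) as (k & _ & Ek).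
  assert (Hk : dvd p ((1 + u + u * s) * k)).
  { rewrite <- Ek, Et. apply dvd_intro. }
  destruct (Hprime _ _ Hk) as [H|(j & _ & Ej)].
  - exfalso. destruct (lt_trichotomy s x) as [Hlt|[->|Hlt]].
    + now apply (Hcop s x).
    + now apply Hxb.
    + now apply (Hcop x s).
  - replace t with ((1 + u + u * s) * j); [apply dvd_intro|].
    apply (mul_cancel_l p); [arith|]. rewrite <- Et, Ek, Ej.
    rewrite !mul_assoc. f_equal. apply mul_comm.
Qed.
End StrongCollection.

Ltac sigma_user ::=
  lazymatch goal with
  | |- S1 (fun e => Exists _ _) => apply S1_Exists; intros
  end.

(** * The coloring *)

Section Coloring.
Context {M : rca_model}.
Local Notation N := (num M).
Local Notation "0" := (mzero M).
Local Notation "1" := (mone M).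
Local Infix "+" := (madd M).
Local Infix "*" := (mmul M).
Local Infix "<" := (mlt M).
Local Notation "x <= y" := (mlt M x (madd M y (mone M))).
Local Notation "'#' k" := (nm k%nat : N) (at level 1, format "# k").

Context (theta : N -> N -> Prop) (Htheta : D0 (fun e => theta (e 0%nat) (e 1%nat))).

(** The logarithm to base 3 in the multiplicative group modulo 7, reduced modulo 3:
    [r], [2 r] and [3 r] always get three different values. *)
Definition chi (r : nat) : nat := nth r [0; 0; 2; 1; 1; 2; 0]%nat 0%nat.

Definition color_data (n : N) (rp : nat * nat) : Prop :=
  exists l a, Pow l /\ n = l * (#7 * a + #(fst rp)) /\ split_parity theta n l #(snd rp).

Definition color_pairs (i : nat) : list (nat * nat) :=
  filter (fun rp => (chi (fst rp) + snd rp) mod 3 =? i)%nat (list_prod (seq 1 6) (seq 0 2)).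

(** A finite disjunction over digits and parities, so that [sigma] recognizes a Sigma01
    predicate. *)
Definition color (n : N) (i : nat) : Prop := Exists (color_data n) (color_pairs i).

Lemma color_spec n i : color n i <-> exists r p,
  (0 < r < 7)%nat /\ (p < 2)%nat /\ ((chi r + p) mod 3 = i)%nat /\ color_data n (r, p).
Proof.
  unfold color. rewrite Exists_exists. split.
  - intros ([r p] & H & Hd). exists r, p. unfold color_pairs in H.
    apply filter_In in H as [[H1 H2]%in_prod_iff H3].
    apply in_seq in H1, H2. apply Nat.eqb_eq in H3.
    split; [lia|]. split; [lia|]. now split.
  - intros (r & p & Hr & Hp & Hi & Hd). exists (r, p). split; [|exact Hd].
    apply filter_In. split; [apply in_prod_iff; split; apply in_seq; lia|].
    now apply Nat.eqb_eq.
Qed.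

Lemma color_data_unique n r p r' p' :
  (0 < r < 7)%nat -> (p < 2)%nat -> (0 < r' < 7)%nat -> (p' < 2)%nat ->
  color_data n (r, p) -> color_data n (r', p') -> r = r' /\ p = p'.
Proof.
  intros Hr Hp Hr' Hp' (l & a & Hl & E & HS) (l' & a' & Hl' & E' & HS'). simpl in *.
  assert (Hll : l = l').
  { apply (lam_unique n).
    - rewrite E. now apply lam_intro, not_dvd7.
    - rewrite E'. now apply lam_intro, not_dvd7. }
  subst l'. rewrite E in E'. apply mul_cancel_l in E'; [|now apply Pow_pos].
  apply mod7_unique in E' as [_ E']; [|lia|lia]. split; [exact E'|].
  assert (H1 : #1 = 1) by (simpl; arith).
  destruct p as [|[|p]]; [| |lia]; (destruct p' as [|[|p']]; [| |lia]); try reflexivity; exfalso;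
    rewrite H1 in *; now apply (split_parity_unique theta Htheta n l).
Qed.

Lemma color_unique n i j : color n i -> color n j -> i = j.
Proof.
  intros (r & p & Hr & Hp & <- & H)%color_spec (r' & p' & Hr' & Hp' & <- & H')%color_spec.
  destruct (color_data_unique n r p r' p') as [-> ->]; auto.
Qed.

Lemma color_exists n : 0 < n -> exists i, (i < 3)%nat /\ color n i.
Proof.
  intros Hn. destruct (lam_exists n Hn) as (l & Hl & v & _ & E & Hv).
  apply not_dvd7_digit in Hv as (a & r & Hr & ->).
  assert (H : exists p, (p < 2)%nat /\ split_parity theta n l #p).
  { destruct (split_parity_exists theta Htheta n l) as [H|H]; [exists 0%nat|exists 1%nat];
      (split; [lia|]); [exact H|]. replace (#1) with 1 by (simpl; arith). exact H. }
  destruct H as (p & Hp & HS). exists ((chi r + p) mod 3)%nat.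
  split; [apply Nat.mod_upper_bound; lia|]. apply color_spec. exists r, p.
  repeat (split; [assumption || reflexivity|]). now exists l, a.
Qed.

Lemma color_digit n i l a r : color n i -> Pow l -> n = l * (#7 * a + #r) -> (0 < r < 7)%nat ->
  exists p, (p < 2)%nat /\ ((chi r + p) mod 3 = i)%nat /\ split_parity theta n l #p.
Proof.
  intros (r' & p & Hr' & Hp & Hi & l' & a' & Hl' & E' & HS)%color_spec Hl E Hr. simpl in *.
  assert (Hll : l' = l).
  { apply (lam_unique n).
    - rewrite E'. now apply lam_intro, not_dvd7.
    - rewrite E. now apply lam_intro, not_dvd7. }
  subst l'. rewrite E in E'. apply mul_cancel_l in E'; [|now apply Pow_pos].
  apply mod7_unique in E' as [_ <-]; [|lia|lia]. now exists p.
Qed.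

Definition pr (x y : N) : N := (x + y) * (x + y) + x.

(** With [s = x + y], the value is at least [s * s] and less than the next square, so it determines
    [s], and then [x]. *)
Lemma pr_inj x y x' y' : pr x y = pr x' y' -> x = x' /\ y = y'.
Proof.
  unfold pr. intros H.
  assert (Hs : x + y = x' + y').
  { remember (x + y) as s eqn:Es. remember (x' + y') as s' eqn:Es'.
    assert (Hx : x <= s) by (rewrite Es; arith). assert (Hx' : x' <= s') by (rewrite Es'; arith).
    clear Es Es'. destruct (lt_trichotomy s s') as [[z ->]%lt_exists|[E|[z ->]%lt_exists]]; [|exact E|].
    - assert (H1 := nlt_0_r (s * z)). assert (H2 := nlt_0_r (z * z)). arith.
    - assert (H1 := nlt_0_r (s' * z)). assert (H2 := nlt_0_r (z * z)). arith. }
  rewrite Hs in H. split; arith.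
Qed.

(** Existence and uniqueness of colors make the Sigma01 graph decidable: a number lies outside if it
    is no pair of a positive number and a color, or if it is such a pair and the first entry has
    another color. *)
Lemma coloring_set : exists c, forall z, mmem M z c <->
  exists n, 0 < n /\ Exists (fun i => z = pr n #i /\ color n i) (seq 0 3).
Proof.
  apply delta_comprehension.
  - unfold color, color_data, split_parity, splits_code, split, digit, new_below, pr. sigma.
  - apply S1_ext with (fun e => ~ (exists n, n < e 0%nat + 1 /\ 0 < n /\
       (e 0%nat = pr n #0 \/ e 0%nat = pr n #1 \/ e 0%nat = pr n #2)) \/
      exists n, 0 < n /\ Exists (fun ij => e 0%nat = pr n #(fst ij) /\ color n (snd ij))
        (filter (fun ij => negb (fst ij =? snd ij)%nat) (list_prod (seq 0 3) (seq 0 3)))).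
    + intros e. generalize (e 0%nat). intros z. split.
      * intros [H|(n & Hn & H)] (n' & Hn' & H').
        -- apply H. exists n'. apply Exists_exists in H' as (i & Hi & E & _).
           split; [rewrite E; unfold pr; assert (H1 := nlt_0_r ((n' + #i) * (n' + #i))); arith|].
           split; [exact Hn'|]. apply in_seq in Hi.
           destruct i as [|[|[|i]]]; [tauto|tauto|tauto|lia].
        -- apply Exists_exists in H as ([i j] & Hij & E & Hc).
           apply filter_In in Hij as [_ Hij]. simpl in *.
           apply Exists_exists in H' as (i' & Hi' & E' & Hc').
           rewrite E in E'. apply pr_inj in E' as [<- E'].
           rewrite (color_unique n i' j Hc' Hc) in E'.
           destruct (Nat.eqb_spec i j) as [|Hne]; [discriminate|].
           destruct (Nat.lt_trichotomy i j) as [Hlt|[Heq|Hlt]]; [|contradiction|];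
             apply (@nm_lt M) in Hlt; arith.
      * intros H. destruct (classic (exists n, n < z + 1 /\ 0 < n /\
          (z = pr n #0 \/ z = pr n #1 \/ z = pr n #2))) as [(n & _ & Hn & E)|HN]; [right|now left].
        assert (Ei : exists i, (i < 3)%nat /\ z = pr n #i).
        { destruct E as [E|[E|E]]; [exists 0%nat|exists 1%nat|exists 2%nat]; (split; [lia|exact E]). }
        destruct Ei as (i & Hi & Ei). destruct (color_exists n Hn) as (j & Hj & Hc).
        exists n. split; [exact Hn|]. apply Exists_exists. exists (i, j). split; [|now split].
        apply filter_In. split; [apply in_prod_iff; split; apply in_seq; lia|]. simpl.
        destruct (Nat.eqb_spec i j) as [->|]; [|reflexivity].
        exfalso. apply H. exists n. split; [exact Hn|]. apply Exists_exists. exists j.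
        split; [apply in_seq; lia|now split].
    + unfold color, color_data, split_parity, splits_code, split, digit, new_below, pr.
      apply S1_or; sigma.
Qed.

(** * Solutions *)

Section Solution.
Context (X : mset M) (i : nat).
Context (Hpos : forall x, mmem M x X -> 0 < x).
Context (Hinf : forall n, exists x, n < x /\ mmem M x X).
Context (H1 : forall x, mmem M x X -> color x i).
Context (H2 : forall x y, mmem M x X -> mmem M y X -> x <> y -> color (x + y) i).
Context (H3 : forall x y z, mmem M x X -> mmem M y X -> mmem M z X ->
  x <> y -> x <> z -> y <> z -> color (x + y + z) i).

(** Forgets the splits: whatever their parity, the color is the character or its successor modulo 3.
    The coefficient [d] may exceed 6, as it does for sums. *)
Lemma color_multiple n j l a d : color n j -> Pow l -> n = l * (#7 * a + #d) ->
  (0 < d mod 7)%nat -> exists p, (p < 2)%nat /\ ((chi (d mod 7) + p) mod 3 = j)%nat.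
Proof.
  intros Hc Hl E Hd.
  destruct (color_digit n j l (a + #(d / 7)) (d mod 7) Hc Hl) as (p & Hp & Hi & _).
  - rewrite E. f_equal. rewrite (Nat.div_mod_eq d 7) at 1. rewrite nm_add, nm_mul. arith.
  - split; [exact Hd|]. apply Nat.mod_upper_bound. lia.
  - now exists p.
Qed.

(** With [d] the lowest nonzero digit of [r], one of the elements, the sum of two and the sum of all
    three have the lowest nonzero digits [d], [2 d], [3 d] modulo 7. Adding 0 or 1 cannot bring
    three different characters to one value. *)
Lemma no_three_congruent Q r x y z : Pow Q -> 0 < r -> r < Q ->
  mmem M (Q * x + r) X -> mmem M (Q * y + r) X -> mmem M (Q * z + r) X ->
  x < y -> y < z -> False.
Proof.
  intros HQ Hr HrQ Hx Hy Hz Hxy Hyz.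
  destruct (lam_exists r Hr) as (l & Hl & v & Hvr & E & Hv).
  assert (HlQ : l < Q).
  { assert (H := dvd_le l r). rewrite E in H at 1. specialize (H (dvd_intro _ _) Hr). arith. }
  destruct (Pow_lt_factor l Q) as (c & Ec); [assumption..|].
  apply not_dvd7_digit in Hv as (a & d & Hd & ->).
  assert (Hne : forall s t, s < t -> Q * s + r <> Q * t + r).
  { intros s t Hst H. destruct (division_unique _ _ _ _ _ HrQ HrQ H) as [-> _]. arith. }
  assert (Hxz : x < z) by arith.
  destruct (color_multiple (Q * x + r) i l (a + c * x) d) as (p1 & Hp1 & Hi1);
    [now apply H1|exact Hl|rewrite E, Ec; arith|rewrite Nat.mod_small; lia|].
  destruct (color_multiple (Q * x + r + (Q * y + r)) i l (a + a + c * x + c * y) (d + d)) as (p2 & Hp2 & Hi2);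
    [now apply H2; auto|exact Hl|rewrite nm_add, E, Ec; arith| |].
  { clear - Hd. do 7 (destruct d as [|d]; [simpl; lia|]). lia. }
  destruct (color_multiple (Q * x + r + (Q * y + r) + (Q * z + r)) i l
    (a + a + a + c * x + c * y + c * z) (d + d + d)) as (p3 & Hp3 & Hi3);
    [now apply H3; auto|exact Hl|rewrite !nm_add, E, Ec; arith| |].
  { clear - Hd. do 7 (destruct d as [|d]; [simpl; lia|]). lia. }
  rewrite <- Hi1 in Hi2, Hi3. clear - Hd Hp1 Hp2 Hp3 Hi2 Hi3.
  do 7 (destruct d as [|d]; [do 2 (destruct p1 as [|p1]; [
    do 2 (destruct p2 as [|p2]; [do 2 (destruct p3 as [|p3]; [simpl in *; lia|]); lia|]); lia|]); lia|]). lia.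
Qed.

(** Otherwise no element of [X] is divisible by a power [Q] of 7 above [B]. It remains to find three
    congruent elements modulo [Q] without the infinite pigeonhole principle. *)
Lemma lam_unbounded B : exists m l, mmem M m X /\ lam m l /\ B <= l.
Proof.
  apply NNPP. intros HN.
  destruct (Pow_unbounded B) as (Q & HQ & HBQ).
  assert (HQ0 := Pow_pos _ HQ).
  assert (Hnd : forall m, mmem M m X -> ~ dvd Q m).
  { intros m Hm Hd. destruct (lam_exists m (Hpos m Hm)) as (l & Hl).
    apply HN. exists m, l. split; [exact Hm|]. split; [exact Hl|].
    assert (H := lam_ge_dvd m l Q Hl (Hpos m Hm) HQ Hd). arith. }
  set (cong r x := mmem M x X /\ exists k, k <= x /\ x = Q * k + r).
  (* The least element of every occupied class lies below [b1], and the second element of every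
     class with at least two lies below [b2]. *)
  destruct (strong_collection cong Q) as [b1 Hb1]; [unfold cong; definable|].
  destruct (strong_collection (fun r x => cong r x /\ exists y, y < x /\ cong r y) Q) as [b2 Hb2];
    [unfold cong; definable|].
  destruct (Hinf (b1 + b2)) as (x & Hx & HxX).
  destruct (division x Q HQ0) as (k & r & E & Hr).
  assert (Hxr : cong r x).
  { split; [exact HxX|]. exists k. split; [|exact E]. rewrite E.
    destruct (succ_or_0 Q) as [->|[t ->]]; [arith|]. assert (H := nlt_0_r (t * k)). arith. }
  (* As [x] is past [b1], its class has an earlier element. So the class has two elements, hence two
     below [b2], and [x] is a third. *)
  destruct (Hb1 r Hr) as (y & Hy & Hyr); [now exists x|].
  destruct (Hb2 r Hr) as (y2 & Hy2 & Hyr2 & y3 & Hy3 & Hyr3).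
  { exists x. split; [exact Hxr|]. exists y. split; [arith|exact Hyr]. }
  destruct Hyr2 as (Hm2 & k2 & _ & E2), Hyr3 as (Hm3 & k3 & _ & E3).
  assert (Hk : forall s t, Q * s + r < Q * t + r -> s < t).
  { clear. intros s t Hst. apply NNPP. intros Hn. 
    destruct (lt_trichotomy s t) as [H|[->|[z ->]%lt_exists]]; [contradiction|arith|].
    assert (H := nlt_0_r (Q * z)). arith. }
  apply (no_three_congruent Q r k3 k2 k HQ); rewrite <- ?E, <- ?E2, <- ?E3; auto.
  - destruct (succ_or_0 r) as [->|[t ->]]; [|arith]. exfalso. apply (Hnd x HxX).
    rewrite E. replace (Q * k + 0) with (Q * k) by arith. apply dvd_intro.
  - apply Hk. rewrite <- E2, <- E3. exact Hy3.
  - apply Hk. rewrite <- E, <- E2. arith.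
Qed.

Lemma enumerated_below n l x : mmem M n X -> lam n l -> x < l ->
  (exists y, theta x y) -> exists y, y < n /\ theta x y.
Proof.
  intros Hn Hl Hx Hex. apply NNPP. intros HN.
  destruct (strong_collection theta l Htheta) as [b Hb].
  (* [q] must exceed [n], so that [n] is the part of [n + m] below [q], and must not be smaller than
     the stage [b]. *)
  destruct (lam_unbounded (b + n + 1)) as (m & q & Hm & Hq & Hbq).
  assert (Hq' := Hq). destruct Hq' as (Hpq & v & _ & Em & Hv).
  destruct Hl as (Hpl & w & Hwn & En & Hw).
  assert (Hlam : lam n l) by (rewrite En; now apply lam_intro).
  assert (Hln : l <= n).
  { assert (H := dvd_le l n). rewrite En in H at 1. exact (H (dvd_intro _ _) (Hpos n Hn)). }
  destruct (Pow_lt_factor l q) as (c & Ec); [assumption..|arith|].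
  apply not_dvd7_digit in Hw as (a & r & Hr & ->).
  assert (Hnm : n <> m).
  { intros ->. assert (H := lam_unique m q l Hq Hlam). subst l. arith. }
  destruct (color_digit n i l a r (H1 n Hn) Hpl En Hr) as (p & Hp & Hi & HS).
  destruct (color_digit (n + m) i l (a + c * v) r (H2 n m Hn Hm Hnm) Hpl) as (p' & Hp' & Hi' & HS');
    [rewrite Em, Ec, En at 1; arith|exact Hr|].
  (* The digit and the color are the same for [n] and [n + m], which leaves only one possible
     parity. *)
  assert (Hpp : p = p').
  { clear - Hp Hp' Hi Hi' Hr. rewrite <- Hi' in Hi.
    do 7 (destruct r as [|r]; [do 2 (destruct p as [|p]; [
      do 2 (destruct p' as [|p']; [simpl in *; lia|]); lia|]); lia|]). lia. }
  subst p'.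
  apply (split_parity_flip theta Htheta n m l b q #p); auto; [arith|arith|now exists x].
Qed.

Lemma enumerated_set : exists Y, forall x, mmem M x Y <-> exists y, theta x y.
Proof.
  apply delta_comprehension.
  - sigma.
  (* Nonmembership has a finite certificate: an element [n] of [X] whose [l] exceeds the number,
     which has not been enumerated before stage [n]. *)
  - apply S1_ext with (fun e => exists n l, mmem M n X /\ lam n l /\ e 0%nat < l /\
      ~ exists y, y < n /\ theta (e 0%nat) y).
    + intros e. generalize (e 0%nat). intros x. split.
      * intros (n & l & Hn & Hl & Hx & HN) Hex. apply HN. now apply enumerated_below with l.
      * intros HN. destruct (lam_unbounded (x + 1)) as (m & l & Hm & Hl & Hx).
        exists m, l. split; [exact Hm|]. split; [exact Hl|]. split; [arith|].
        intros (y & _ & Hy). apply HN. now exists y.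
    + unfold lam. sigma.
Qed.
End Solution.
End Coloring.

(** * From Hindman's theorem to arithmetical comprehension *)

Section Hindman.
Context {M : rca_model}.
Local Notation N := (num M).
Local Notation "0" := (mzero M).
Local Notation "1" := (mone M).
Local Infix "+" := (madd M).
Local Infix "*" := (mmul M).
Local Infix "<" := (mlt M).
Local Notation "x <= y" := (mlt M x (madd M y (mone M))).
Local Notation "'#' k" := (nm k%nat : N) (at level 1, format "# k").

Lemma eval_numeral (e : nat -> N) k : eval M e (numeral k) = nm k.
Proof. induction k as [|k IH]; simpl; [reflexivity|]. now rewrite IH. Qed.

Lemma sat_FS e (E : nat -> mset M) X t : sat M e E (FS 3 X t) <->
  (exists x, mmem M x (E X) /\ eval M e t = x) \/
  (exists y x, mmem M x (E X) /\ mmem M y (E X) /\ x <> y /\ eval M e t = x + y) \/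
  (exists z y x, mmem M x (E X) /\ mmem M y (E X) /\ mmem M z (E X) /\
    x <> y /\ x <> z /\ y <> z /\ eval M e t = x + y + z).
Proof.
  assert (H0 : forall x : N, x + 0 = x) by apply add_0_r.
  unfold FS, is_sum, tshift. simpl. rewrite ?eval_subst. simpl.
  repeat setoid_rewrite eval_subst. simpl. repeat setoid_rewrite H0.
  repeat setoid_rewrite add_assoc.
  split.
  - intros [(x & H)|[(y & x & H)|[(z & y & x & H)|[]]]].
    + left. exists x. tauto.
    + right. left. exists y, x. tauto.
    + right. right. exists z, y, x. tauto.
  - intros [(x & H)|[(y & x & H)|(z & y & x & H)]].
    + left. exists x. tauto.
    + right. left. exists y, x. tauto.
    + right. right. left. exists z, y, x. tauto.
Qed.

Context (e0 : nat -> N) (E0 : nat -> mset M) (HHT : sat M e0 E0 (HT 3 3)).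

Lemma enumerable_set (theta : N -> N -> Prop) :
  D0 (fun e => theta (e 0%nat) (e 1%nat)) ->
  exists Y, forall x, mmem M x Y <-> exists y, theta x y.
Proof.
  intros Htheta. destruct (coloring_set theta Htheta) as [c Hc].
  assert (Hcol : forall n i, 0 < n -> (i < 3)%nat ->
    mmem M (pr n #i) c <-> color theta n i).
  { intros n i Hn Hi. rewrite Hc. split.
    - intros (n' & Hn' & H). apply Exists_exists in H as (j & Hj & E & H).
      apply pr_inj in E as [<- E]. replace i with j; [exact H|].
      destruct (Nat.lt_trichotomy i j) as [Hlt|[Heq|Hlt]]; [|now symmetry|];
        apply (@nm_lt M) in Hlt; arith.
    - intros H. exists n. split; [exact Hn|]. apply Exists_exists. exists i.
      split; [apply in_seq; lia|now split]. }
  destruct (HHT c) as (X & Hpos & Hinf & Hmono).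
  { split.
    - intros z Hz. apply Hc in Hz as (n & Hn & H). apply Exists_exists in H as (i & Hi & E & _).
      exists n, #i. split; [exact Hn|]. split; [|exact E].
      change (#i < eval M (scons #i (scons n (scons z e0))) (numeral 3)).
      rewrite eval_numeral. apply nm_lt. apply in_seq in Hi. lia.
    - intros n Hn. destruct (color_exists theta Htheta n Hn) as (i & Hi & H).
      exists #i. split; [now apply Hcol|].
      intros j Hj. change (mmem M (pr n j) c) in Hj. change (j = #i).
      apply Hc in Hj as (n' & _ & Hj). apply Exists_exists in Hj as (i' & _ & E & H').
      apply pr_inj in E as [<- ->]. f_equal. now apply (color_unique theta Htheta n). }
  (* The element [x0] fixes the color [i]; monochromaticity is used only to compare sums with it. *)
  destruct (Hinf 0) as (x0 & Hx0 & Hx0X). 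
  change (0 < x0) in Hx0. change (mmem M x0 X) in Hx0X.
  destruct (color_exists theta Htheta x0 Hx0) as (i & Hi & Hci).
  assert (HFS : forall z, 0 < z ->
    sat M (scons x0 (scons z e0)) (scons X (scons c E0)) (FS 3 0 (tVar 1)) -> color theta z i).
  { intros z Hz HF. 
    destruct (Hmono z x0) as (j & Hj & Hj').
    - split; [exact HF|]. apply sat_FS. left. now exists x0.
    - change (mmem M (pr z j) c) in Hj. change (mmem M (pr x0 j) c) in Hj'.
      apply Hc in Hj' as (n & _ & H). apply Exists_exists in H as (k & Hk & E & H).
      apply pr_inj in E as [<- ->]. rewrite (color_unique theta Htheta _ _ _ Hci H).
      apply in_seq in Hk. apply Hcol; [exact Hz|lia|exact Hj]. }
  assert (Hpos' : forall x, mmem M x X -> 0 < x) by exact Hpos.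
  apply (enumerated_set theta Htheta X i).
  - exact Hpos'.
  - exact Hinf.
  - intros x Hx. apply HFS; [now apply Hpos'|]. apply sat_FS. left. now exists x.
  - intros x y Hx Hy Hxy. assert (Hx1 := Hpos' _ Hx). apply HFS; [arith|].
    apply sat_FS. right. left. now exists y, x.
  - intros x y z Hx Hy Hz Hxy Hxz Hyz. assert (Hx1 := Hpos' _ Hx). apply HFS; [arith|].
    apply sat_FS. right. right. exists z, y, x. repeat split; assumption.
Qed.

(** * Elimination of number quantifiers in favor of set parameters *)

Definition supported (k : nat) (P : (nat -> N) -> Prop) : Prop :=
  forall e e', (forall i, (i < k)%nat -> e i = e' i) -> P e <-> P e'.

Lemma S1_rename (P : (nat -> N) -> Prop) (xi : nat -> nat) :
  S1 P -> S1 (fun e => P (fun n => e (xi n))).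
Proof.
  intros (Q & HQ & HP). exists (fun x e => Q x (fun n => e (xi n))).
  split; [|intros e; apply HP].
  exact (D0_rename _ (fun n => match n with O => O | S n => S (xi n) end) HQ).
Qed.

(** The support is reduced to a single variable by pairing. *)
Lemma S1_D0 k P : S1 P -> supported k P -> D0 P.
Proof.
  revert P. induction k as [|[|k] IH]; intros P HP Hk.
  - destruct (classic (P (fun _ => 0))) as [H|H].
    + apply D0_ext with (fun _ => ~ False); [|apply D0_not, D0_False].
      intros e. rewrite (Hk e (fun _ => 0)); [tauto|lia].
    + apply D0_ext with (fun _ => False); [|apply D0_False].
      intros e. rewrite (Hk e (fun _ => 0)); [tauto|lia].
  (* With one variable, the predicate is the range of an enumeration, hence a set, and membership in
     a set is bounded. *)
  - destruct HP as (Q & HQ & HP).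
    destruct (enumerable_set (fun x y => Q y (scons x (fun _ => 0)))) as [Y HY].
    + set (xi := fun n => match n with O => inl 1%nat | S O => inl 0%nat | _ => inr 0 end).
      apply D0_ext with (fun e => Q (wire xi e 0%nat) (fun n => wire xi e (S n)));
        [|exact (D0_rewire _ xi HQ)].
      intros e. replace (fun n => wire xi e (S n)) with (scons (e 0%nat) (fun _ => 0)); [reflexivity|].
      apply functional_extensionality; intros [|n]; reflexivity.
    + apply D0_ext with (fun e => mmem M (e 0%nat) Y); [|definable].
      intros e. rewrite HY, <- HP. apply Hk. intros [|i] Hi; [reflexivity|lia].
  (* Position 0 of [P'] holds the pair of the first two positions of [P], so the support shrinks by
     one. *)
  - set (P' := fun e : nat -> N => exists a, a < e 0%nat + 1 /\ exists b, b < e 0%nat + 1 /\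
      e 0%nat = pr a b /\ P (scons a (scons b (fun n => e (S n))))).
    assert (HP' : D0 P').
    { apply IH.
      - unfold P', pr. apply S1_ex, S1_and; [sigma|]. apply S1_ex, S1_and; [sigma|].
        apply S1_and; [sigma|].
        set (xi := fun n => match n with O => 1 | S O => 0 | n => S n end%nat).
        apply S1_ext with (fun e => P (fun n => e (xi n))); [|now apply S1_rename].
        intros e. replace (fun n => e (xi n)) with
          (scons (e 1%nat) (scons (e 0%nat) (fun n => e (S (S (S n)))))); [reflexivity|].
        apply functional_extensionality; intros [|[|n]]; reflexivity.
      - intros e e' H. unfold P'. rewrite (H 0%nat) by lia.
        assert (HE : forall a b, P (scons a (scons b (fun n => e (S n)))) <->
          P (scons a (scons b (fun n => e' (S n))))).
        { intros a b. apply Hk. intros [|[|i]] Hi; [reflexivity|reflexivity|]. apply H. lia. }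
        setoid_rewrite HE. reflexivity. }
    apply D0_ext with (fun e => exists z, z < pr (e 0%nat) (e 1%nat) + 1 /\
      z = pr (e 0%nat) (e 1%nat) /\ P' (scons z (fun n => e (S (S n))))).
    + intros e. split.
      * intros (z & _ & -> & a & _ & b & _ & E & H). simpl in E. apply pr_inj in E as [<- <-].
        simpl in H. eapply Hk; [|exact H]. intros [|[|i]] _; reflexivity.
      * intros H. exists (pr (e 0%nat) (e 1%nat)). split; [arith|]. split; [reflexivity|].
        exists (e 0%nat). simpl. split; [unfold pr; assert (H1 := nlt_0_r ((e 0%nat + e 1%nat) * (e 0%nat + e 1%nat))); arith|].
        exists (e 1%nat). split.
        { unfold pr. destruct (succ_or_0 (e 1%nat)) as [->|[t ->]]; [arith|].
          assert (H1 := nlt_0_r (e 0%nat * e 0%nat)). assert (H2 := nlt_0_r (e 0%nat * t)).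
          assert (H3 := nlt_0_r (t * t)). arith. }
        split; [reflexivity|]. eapply Hk; [|exact H]. intros [|[|i]] _; reflexivity.
    + unfold pr. apply D0_bex; [definable|]. apply D0_and; [definable|].
      set (xi := fun n => match n with O => 0 | S n => S (S (S n)) end%nat).
      apply D0_ext with (fun e => P' (fun n => e (xi n))); [|now apply D0_rename].
      intros e. replace (fun n => e (xi n)) with (scons (e 0%nat) (fun n => e (S (S (S n)))));
        [reflexivity|].
      apply functional_extensionality; intros [|n]; reflexivity.
Qed.

Lemma eval_agree (e e' : nat -> N) t :
  (forall i, (i < term_bound t)%nat -> e i = e' i) -> eval M e t = eval M e' t.
Proof.
  induction t; simpl; intros H; auto; rewrite IHt1, IHt2; auto; intros; apply H; lia.
Qed.

Lemma sat_supported A (E : nat -> mset M) : supported (num_bound A) (fun e => sat M e E A).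
Proof.
  unfold supported. revert E; induction A; simpl; intros E e e' H;
    try (rewrite (eval_agree e e' s), (eval_agree e e' t); [reflexivity|..]; intros; apply H; lia);
    try (rewrite (IHA1 E e e'), (IHA2 E e e'); [reflexivity|..]; intros; apply H; lia).
  - reflexivity.
  - rewrite (eval_agree e e' t); [reflexivity|exact H].
  - split; intros H' x; (eapply IHA; [|exact (H' x)]);
      (intros [|i] Hi; simpl; [reflexivity|]); [symmetry|]; apply H; lia.
  - split; intros [x H']; exists x; (eapply IHA; [|exact H']);
      (intros [|i] Hi; simpl; [reflexivity|]); [symmetry|]; apply H; lia.
  - split; intros H' x; (eapply IHA; [|exact (H' x)]); intros i Hi; [symmetry|]; now apply H.
  - split; intros [x H']; exists x; (eapply IHA; [|exact H']); intros i Hi; [symmetry|]; now apply H.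
Qed.

Lemma TM_eval t : TM (fun e => eval M e t).
Proof. exists t, inl. reflexivity. Qed.

(** Bounded predicates may have set parameters, so the set obtained for one quantifier can be used
    under the next. Existential quantifiers are absorbed by [S1_D0], universal ones by negation. *)
Lemma arithmetical_D0 A (E : nat -> mset M) : arithmetical A -> D0 (fun e => sat M e E A).
Proof.
  assert (Hex : forall B, D0 (fun e => sat M e E B) -> D0 (fun e => sat M e E (fEx B))).
  { intros B HB. apply (S1_D0 (num_bound (fEx B))); [|apply sat_supported].
    simpl. apply S1_ex, D0_S1. apply D0_ext with (2 := HB). intros e. now rewrite scons_eta. }
  induction A; simpl; intros HA; try contradiction.
  - apply D0_False.
  - apply TM_D0_eq; apply TM_eval.
  - apply TM_D0_lt; apply TM_eval.
  - apply TM_D0_mem, TM_eval.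
  - destruct HA. apply D0_imp; auto.
  - destruct HA. apply D0_and; auto.
  - destruct HA. apply D0_or; auto.
  - apply D0_ext with (fun e => ~ sat M e E (fEx (fNeg A))).
    + intros e. simpl. split; [|intros H [x Hx]; auto].
      intros H x. apply NNPP. intros Hx. apply H. now exists x.
    + apply D0_not, Hex. simpl. apply D0_not. auto.
  - now apply Hex, IHA.
Qed.

Lemma arithmetical_comprehension A e (E : nat -> mset M) :
  arithmetical A -> sat M e E (comprehension A).
Proof.
  intros HA. assert (H := arithmetical_D0 A E HA).
  (* All variables except the comprehension variable are frozen at their values in [e]. *)
  set (xi := fun n => match n with O => inl 0%nat | S n => inr (e n) end).
  assert (HD : D0 (fun e' => sat M (scons (e' 0%nat) e) E A)).
  { apply D0_ext with (fun e' => sat M (wire xi e') E A); [|exact (D0_rewire _ xi H)].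
    intros e'. replace (wire xi e') with (scons (e' 0%nat) e); [reflexivity|].
    apply functional_extensionality; intros [|n]; reflexivity. }
  destruct (delta_comprehension (fun x => sat M (scons x e) E A)) as [Y HY].
  - now apply D0_S1.
  - now apply D0_S1, D0_not.
  - exists Y. intros x. simpl. unfold shiftS. rewrite sat_subst. simpl. rewrite HY. split; auto.
Qed.
End Hindman.

Theorem corollary3p4 :
  forall A : form, ACA0 A -> proves RCA0 (fImp (HT 3 3) A).
Proof.
  intros A HA. apply completeness; [exact RCA0_subst_closed|].
  intros M HM e E HHT. destruct HA as [A HA|A HA]; [now apply HM|].
  (* A set environment always provides some set; [E 0] serves as the default one. *)
  exact (@arithmetical_comprehension (RcaModel M HM (E 0)) e E HHT A e E HA).
Qed.
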